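(* Let $n\ge 1$, $d\ge 1$ be integers, let $\mathbf{X}=S^{n-1}\times S^{n-1}=\{(\mathbf{x},\mathbf{y})\in\mathbb{R}^n\times\mathbb{R}^n:\ 1-\|\mathbf{x}\|^2=0,\ 1-\|\mathbf{y}\|^2=0\}$, and let $q\in\mathbb{R}[\mathbf{x},\mathbf{y}]$ be a polynomial of degree $d$, with $q_{\min}=\min_{(\mathbf{x},\mathbf{y})\in\mathbf{X}}q(\mathbf{x},\mathbf{y})$ and $q_{\max}=\max_{(\mathbf{x},\mathbf{y})\in\mathbf{X}}q(\mathbf{x},\mathbf{y})$. Then for every integer $t\ge 2nd\sqrt{d}$, $$q_{\min}-\mathrm{lb}(q,\mathcal{T}(\mathbf{X}))_{2t}\le \frac{C_{\mathbf{X}}(n,d)}{t^2}\,(q_{\max}-q_{\min}),$$ where $C_{\mathbf{X}}(n,d):=8\,n^2 d^3\binom{d+2}{2}\,\gamma(S^{n-1})_d^2$ depends only on $n$ and $d$.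
   Context: For $\mathbf{x}\in\mathbb{R}^n$, $\|\mathbf{x}\|$ is the Euclidean norm. $\Sigma[\mathbf{x},\mathbf{y}]$ denotes the cone of sums of squares of real polynomials. For an integer $s$, the truncated preordering of $\mathbf{X}$ is $\mathcal{T}(\mathbf{X})_{2s}:=\{\sigma+h_1(1-\|\mathbf{x}\|^2)+h_2(1-\|\mathbf{y}\|^2):\ \sigma\in\Sigma[\mathbf{x},\mathbf{y}],\ \deg\sigma\le 2s,\ h_1,h_2\in\mathbb{R}[\mathbf{x},\mathbf{y}],\ \deg h_i\le 2s-2\}$, and $\mathrm{lb}(q,\mathcal{T}(\mathbf{X}))_s:=\sup\{\tau\in\mathbb{R}:\ q-\tau\in\mathcal{T}(\mathbf{X})_{2s}\}$. Harmonic constant: equip $S^{n-1}$ with the uniform (rotation-invariant) probability measure; let $H_k$ be the space of spherical harmonics of degree $k$ (restrictions to $S^{n-1}$ of harmonic homogeneous polynomials of degree $k$). Every $p\in\mathbb{R}[\mathbf{x}]_d$ (polynomials of degree at most $d$) satisfies $p=\sum_{k=0}^d p_k$ on $S^{n-1}$ with $p_k\in H_k$ (orthogonal projections). With $\|p\|_{S^{n-1}}=\max_{\mathbf{x}\in S^{n-1}}|p(\mathbf{x})|$, define $\gamma(S^{n-1})_d:=\max_{p\in\mathbb{R}[\mathbf{x}]_d,\,p\not\equiv 0 \text{ on } S^{n-1}}\ \max_{0\le k\le d}\|p_k\|_{S^{n-1}}/\|p\|_{S^{n-1}}$. *)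

(* Defs.v *)
From HB Require Import structures.
From mathcomp Require Import all_boot all_order all_algebra.
From mathcomp Require Import mpoly.
(* mpoly must be imported BEFORE the analysis files (notation-level clash otherwise) *)
From mathcomp Require Import classical_sets boolp reals constructive_ereal ereal.

Unset Strict Implicit.
Unset Printing Implicit Defensive.

Import Order.TTheory GRing.Theory Num.Theory.
Local Open Scope classical_set_scope.
Local Open Scope ring_scope.


Notation RPoly R m := (mpoly.mpoly m R).

Section Defs.
Context {R : realType}.

Local Notation Poly m := (mpoly.mpoly m R).


(** total degree (degree of the zero polynomial is taken to be 0) *)
Definition pdeg {m : nat} (p : Poly m) : nat := (msize p).-1.

Definition pvar {m : nat} (i : 'I_m) : Poly m := @mpoly.mpolyX m R (mpoly.mnm1 i).

Definition pconst {m : nat} (c : R) : Poly m := @mpoly.mpolyC m R c.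

Definition peval {m : nat} (p : Poly m) (v : 'I_m -> R) : R := mpoly.meval v p.

Definition sphere (n : nat) : set ('I_n -> R) :=
  [set x | \sum_(i < n) x i ^+ 2 = 1].

Definition laplacian {n : nat} (p : Poly n) : Poly n :=
  \sum_(i < n) mpoly.mderiv i (mpoly.mderiv i p).

(** p is a harmonic homogeneous polynomial of degree k (its restriction to
    S^{n-1} is a spherical harmonic of degree k, i.e. an element of H_k) *)
Definition harm_homog {n : nat} (k : nat) (p : Poly n) : Prop :=
  p \in ishomog1 k (Measure.clone n (@mdeg n) _) /\ laplacian p = 0.

Definition supnorm_S {n : nat} (p : Poly n) : R :=
  sup [set `|peval p x| | x in sphere n].

Definition harm_decomp {n : nat} (d : nat) (p : Poly n) (pk : nat -> Poly n) : Prop :=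
  (forall k, (k <= d)%N -> harm_homog k (pk k)) /\
  (forall x, sphere n x -> peval p x = \sum_(k < d.+1) peval (pk k) x).

Definition gammaS (n d : nat) : R :=
  sup [set r | exists (p : Poly n) (pk : nat -> Poly n) (k : nat),
        [/\ (pdeg p <= d)%N, (exists2 x, sphere n x & peval p x != 0),
            harm_decomp d p pk, (k <= d)%N &
            r = supnorm_S (pk k) / supnorm_S p]].

Definition Xset (n : nat) : set ('I_(n + n) -> R) :=
  [set v | sphere n (fun i => v (lshift n i)) /\ sphere n (fun i => v (rshift n i))].

Definition gx (n : nat) : Poly (n + n) := pconst 1 - \sum_(i < n) pvar (lshift n i) ^+ 2.
Definition gy (n : nat) : Poly (n + n) := pconst 1 - \sum_(i < n) pvar (rshift n i) ^+ 2.

Definition is_sos {m : nat} (p : Poly m) : Prop :=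
  exists s : seq (Poly m), p = \sum_(f <- s) f ^+ 2.

Definition in_TX (n s : nat) (f : Poly (n + n)) : Prop :=
  exists (sigma h1 h2 : Poly (n + n)),
    [/\ is_sos sigma, (pdeg sigma <= 2 * s)%N,
        (pdeg h1 <= 2 * s - 2)%N, (pdeg h2 <= 2 * s - 2)%N &
        f = sigma + h1 * gx n + h2 * gy n].

(** lb(q, T(X))_s, valued in the extended reals (-oo if the set is empty) *)
Definition lbTX (n : nat) (q : Poly (n + n)) (s : nat) : \bar R :=
  ereal_sup [set (tau%:E)%E | tau in [set tau | in_TX n s (q - pconst tau)]].

Definition qmin (n : nat) (q : Poly (n + n)) : R := inf [set peval q v | v in Xset n].
Definition qmax (n : nat) (q : Poly (n + n)) : R := sup [set peval q v | v in Xset n].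

Definition CX (n d : nat) : R :=
  8 * (n%:R) ^+ 2 * (d%:R) ^+ 3 * ('C(d + 2, 2))%:R * gammaS n d ^+ 2.

End Defs.

(* Main.v *)
Require Import Defs.
From HB Require Import structures.
From mathcomp Require Import all_boot all_order all_algebra.
From mathcomp Require Import mpoly.
From mathcomp Require Import complex.
From mathcomp Require Import classical_sets boolp reals constructive_ereal ereal.
From mathcomp Require Import ring lra zify.
Set Implicit Arguments.
Unset Strict Implicit.
Unset Printing Implicit Defensive.
Import Order.TTheory GRing.Theory Num.Theory.
Local Open Scope ring_scope.

(* The polynomial kernel method. Let f = q - q_min, and let K be the operator f |-> \int u(x.x')^2 u(y.y')^2 f(x', y') on functions on X, with u univariate of degree at most t. By the Funk-Hecke formula K acts on H_k (x) H_l as the scalar lam_k lam_l, so if K^-1 (f + eps) >= 0 on X, then f + eps = K (K^-1 (f + eps)) is an integral of squares with nonnegative weights. The components f_kl of f satisfy |f_kl| <= gamma^2 max |f|, and there are binom(d + 2, 2) pairs with k + l <= d, so the eps of the theorem is large enough provided that |1 / (lam_k lam_l) - 1| <= 8 n^2 d^3 / t^2.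

The uniform measure is replaced by a finitely supported one with the same moments up to degree 2t + d, the radial projection of a product of Gauss-Hermite rules; the integral becomes a finite sum of squares.

For u = \sum_(j <= t) (t + 1 - j) Z_j, with Z_j the reproducing kernel of H_j, the gap 1 - lam_1 is a ratio of a Dirichlet form to a norm, which can be summed in closed form and is at most n^2 / (2 t^2). Testing the Funk-Hecke formula on Re (x_1 + i x_2)^k gives 1 - lam_k <= k^2 (1 - lam_1).

Finally a polynomial of bidegree at most (2t, 2t) vanishing on X lies in the ideal of X with the required degree bounds, because its bihomogenization vanishes identically. *)

(** * Harmonic polynomials *)

Section Harmonic.
Variables (R : realType) (n : nat).
Implicit Types (p q f : {mpoly R[n]}) (x a : 'I_n -> R).

Definition sqnorm_poly : {mpoly R[n]} := \sum_(i < n) 'X_i ^+ 2.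
Definition linear_form a : {mpoly R[n]} := \sum_(i < n) a i *: 'X_i.
Definition dir_deriv a p : {mpoly R[n]} := \sum_(i < n) a i *: p^`M(i).

Fact laplacian_is_linear : linear (@laplacian R n).
Proof.
move=> c p q; rewrite /laplacian scaler_sumr -big_split /=.
by apply: eq_bigr => i _; rewrite !linearP.
Qed.

HB.instance Definition _ :=
  GRing.isLinear.Build R {mpoly R[n]} {mpoly R[n]} _ (@laplacian R n)
    laplacian_is_linear.

Lemma mderiv_var i j : ('X_j : {mpoly R[n]})^`M(i) = (i == j)%:R.
Proof.
rewrite mderivX mnm1E eq_sym; case: eqP => [->|_]; last by rewrite scale0r.
by rewrite scale1r -[X in (X - _)%MM](add0m) addmK mpolyX0.
Qed.

Lemma laplacian_varM i p :
  laplacian ('X_i * p) = 'X_i * laplacian p + p^`M(i) *+ 2.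
Proof.
rewrite /laplacian mulr_sumr.
have E j : ('X_i * p)^`M(j)^`M(j) =
    'X_i * p^`M(j)^`M(j) + (if j == i then p^`M(j) *+ 2 else 0).
  rewrite mderivM mderiv_var; case: (j =P i) => [->|/eqP/negPf ji].
    by rewrite mul1r mderivD mderivM mderiv_var eqxx mul1r; ring.
  by rewrite mul0r add0r mderivM mderiv_var ji mul0r add0r addr0.
by rewrite (eq_bigr _ (fun j _ => E j)) big_split /= -big_mkcond big_pred1_eq.
Qed.

Lemma laplacian_linear_formM a p :
  laplacian (linear_form a * p) =
  linear_form a * laplacian p + dir_deriv a p *+ 2.
Proof.
rewrite /linear_form /dir_deriv !mulr_suml linear_sum -sumrMnl -big_split /=.
apply: eq_bigr => i _.
by rewrite -!scalerAl linearZ /= laplacian_varM scalerDr scalerMnr.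
Qed.

Lemma euler_homog k p :
  p \is k.-homog -> \sum_(i < n) 'X_i * p^`M(i) = p *+ k.
Proof.
move=> /dhomogP hp; rewrite [in RHS](mpolyE p) {1}(mpolyE p) -sumrMnl.
under eq_bigr do rewrite linear_sum mulr_sumr.
rewrite exchange_big /= big_seq [RHS]big_seq; apply: eq_bigr => m /hp hm.
rewrite -(hm : mdeg m = k) mdegE -scaler_nat natr_sum scaler_suml; apply: eq_bigr => i _.
rewrite mderivZ -scalerAr mderivX -scalerAr scalerA mulrC -scalerA.
case: (posnP (m i)) => [->|mi]; first by rewrite !scale0r.
congr (_ *: (_ *: _)); rewrite -mpolyXD; congr 'X_[_].
apply/mnmP => j; rewrite mnmDE mnmBE mnm1E.
by case: eqP => [<-|_]; rewrite ?add0n ?subn0 // add1n subn1 prednK.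
Qed.

Lemma laplacian_sqnormM p :
  laplacian (sqnorm_poly * p) =
  sqnorm_poly * laplacian p + (\sum_(i < n) 'X_i * p^`M(i)) *+ 4 + p *+ (2 * n).
Proof.
have -> : p *+ (2 * n) = \sum_(i < n) p *+ 2.
  by rewrite sumr_const card_ord mulrnA.
rewrite /sqnorm_poly !mulr_suml linear_sum -sumrMnl -!big_split /=.
apply: eq_bigr => i _.
rewrite -mulrA !laplacian_varM mderivM mderiv_var eqxx mul1r.
ring.
Qed.

Lemma mderiv_homog k i p : p \is k.-homog -> p^`M(i) \is (k.-1).-homog.
Proof.
move=> /dhomogP hp; rewrite (mpolyE p) linear_sum /= big_seq.
apply: rpred_sum => m /hp hm; rewrite mderivZ mderivX; apply/rpredZ.
case: (posnP (m i)) => [->|mi]; first by rewrite scale0r rpred0.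
have le_im : (U_(i) <= m)%MM by rewrite lep1mP -lt0n.
apply/rpredZ; rewrite dhomogX /= -(hm : mdeg m = k) -{2}(submK le_im).
by rewrite mdegD mdeg1 addn1.
Qed.

Lemma mderiv_homog0 i p : p \is 0.-homog -> p^`M(i) = 0.
Proof.
move=> /dhomogP hp; rewrite (mpolyE p) linear_sum /= big_seq big1 // => m /hp /eqP.
by rewrite mdeg_eq0 => /eqP ->; rewrite mderivZ mderivX mnm0E scale0r scaler0.
Qed.

Lemma linear_form_homog a : linear_form a \is 1.-homog.
Proof. by apply: rpred_sum => i _; apply/rpredZ; rewrite dhomogX /= mdeg1. Qed.

Lemma sqnorm_homog : sqnorm_poly \is 2.-homog.
Proof.
apply: rpred_sum => i _; rewrite -[2%N]/(1 * 2)%N; apply: dhomogMn.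
by rewrite dhomogX /= mdeg1.
Qed.

Lemma laplacian_mderiv i p : laplacian (p^`M(i)) = (laplacian p)^`M(i).
Proof.
rewrite /laplacian linear_sum; apply: eq_bigr => j _.
by rewrite /= (mderiv_comm j i) (mderiv_comm j i).
Qed.

Lemma harm_homog0 k : harm_homog k (0 : {mpoly R[n]}).
Proof. by split; [exact: rpred0 | exact: linear0]. Qed.

Lemma harm_homog1 : harm_homog 0 (1 : {mpoly R[n]}).
Proof.
split; first exact: dhomog1.
by rewrite /laplacian big1 // => i _; rewrite -mpolyC1 mderivC mderiv0.
Qed.

Lemma harm_homogD k p q :
  harm_homog k p -> harm_homog k q -> harm_homog k (p + q).
Proof.
case=> hp lp [hq lq]; split; first exact: rpredD.
by rewrite linearD /= lp lq addr0.
Qed.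

Lemma harm_homogZ k c p : harm_homog k p -> harm_homog k (c *: p).
Proof.
case=> hp lp; split; first exact: rpredZ.
by rewrite linearZ /= lp scaler0.
Qed.

Lemma harm_homog_sum k (I : Type) (r : seq I) (F : I -> {mpoly R[n]}) :
  (forall i, harm_homog k (F i)) -> harm_homog k (\sum_(i <- r) F i).
Proof.
move=> h; elim/big_ind: _ => //; [exact: harm_homog0 | exact: harm_homogD].
Qed.

Lemma harm_dir_deriv k a p :
  harm_homog k p -> harm_homog k.-1 (dir_deriv a p).
Proof.
case=> hp lp; apply: harm_homog_sum => i; apply: harm_homogZ.
by split; [exact: mderiv_homog | rewrite laplacian_mderiv lp linear0].
Qed.

Lemma dir_deriv_homog0 a p : p \is 0.-homog -> dir_deriv a p = 0.
Proof. by move=> h; rewrite /dir_deriv big1 // => i _; rewrite mderiv_homog0 ?scaler0. Qed.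

(** The constant that makes [harm_raise] harmonic. For k = 0 the truncated subtraction may give 0,
    with inverse 0 by convention; the derivative that it multiplies then vanishes. *)
Definition harm_coef (k : nat) : R := (n + k.*2 - 2)%:R^-1.

Definition harm_raise a k f : {mpoly R[n]} :=
  linear_form a * f - harm_coef k *: (sqnorm_poly * dir_deriv a f).

(** With g = [dir_deriv a f] harmonic of degree k - 1, Euler's identity gives Delta(|X|^2 g) = 2 (n
    + 2k - 2) g, while Delta((a . X) f) = 2 g; the coefficient balances the two. *)
Lemma harm_raiseP k a f : (0 < n)%N ->
  harm_homog k f -> harm_homog k.+1 (harm_raise a k f).
Proof.
move=> n0 hf; have [hh lf] := hf.
have [dh dl] := harm_dir_deriv a hf.
case: k => [|k] in hf hh dh *.
  rewrite /harm_raise dir_deriv_homog0 // mulr0 scaler0 subr0.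
  split; first by rewrite -(add0n 1%N) addnC; exact: dhomogM (linear_form_homog a) hh.
  by rewrite laplacian_linear_formM lf mulr0 dir_deriv_homog0 // mul0rn addr0.
split.
  apply: rpredB.
    by rewrite -(add1n k.+1); exact: dhomogM (linear_form_homog a) hh.
  by apply/rpredZ; rewrite -(add2n k); exact: dhomogM sqnorm_homog dh.
rewrite linearB /= linearZ /= laplacian_linear_formM laplacian_sqnormM dl lf.
rewrite !mulr0 !add0r (euler_homog dh) /= -!mulrnA -mulrnDr.
rewrite -(scaler_nat _ (dir_deriv a f)) -scaler_nat scalerA -scalerBl.
have -> : (k * 4 + 2 * n = 2 * (n + k.+1.*2 - 2))%N by lia.
rewrite /harm_coef natrM mulrC -mulrA divff ?mulr1 ?subrr ?scale0r //.
by rewrite pnatr_eq0; lia.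
Qed.

(** Since |x|^2 = 1 on the sphere, multiplication by a . x maps H_k into H_(k+1) + H_(k-1).
    Iterating this splitting yields both the harmonic decomposition and the Funk-Hecke formula. *)
Lemma harm_raise_eval a k f x : sphere n x ->
  (linear_form a).@[x] * f.@[x] =
  (harm_raise a k f).@[x] + harm_coef k * (dir_deriv a f).@[x].
Proof.
move=> hx; rewrite /harm_raise mevalB mevalZ !mevalM.
have -> : sqnorm_poly.@[x] = 1.
  rewrite -hx /sqnorm_poly (big_morph _ (mevalD x) (meval0 x)).
  by apply: eq_bigr => i _; rewrite rmorphXn /= mevalXU.
by rewrite mul1r subrK.
Qed.

Lemma eval_linear_form a x : (linear_form a).@[x] = \sum_(i < n) a i * x i.
Proof.
rewrite /linear_form (big_morph _ (mevalD x) (meval0 x)).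
by apply: eq_bigr => i _; rewrite mevalZ mevalXU.
Qed.

Lemma eval_dir_deriv k f x : f \is k.-homog ->
  (dir_deriv x f).@[x] = k%:R * f.@[x].
Proof.
move=> /euler_homog /(congr1 (meval x)); rewrite mevalMn mulr_natl => <-.
rewrite /dir_deriv !(big_morph _ (mevalD x) (meval0 x)).
by apply: eq_bigr => i _; rewrite mevalZ mevalM mevalXU.
Qed.

End Harmonic.

Section HarmonicDecomposition.
Variables (R : realType) (n : nat).
Hypothesis n_gt0 : (0 < n)%N.

Lemma harm_decomp_var i (p : {mpoly R[n]}) d (h : nat -> {mpoly R[n]}) :
  (forall k, harm_homog k (h k)) -> (forall k, (d < k)%N -> h k = 0) ->
  (forall x, sphere n x -> p.@[x] = \sum_(k < d.+1) (h k).@[x]) ->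
  exists h' : nat -> {mpoly R[n]},
    [/\ forall k, harm_homog k (h' k), forall k, (d.+1 < k)%N -> h' k = 0 &
      forall x, sphere n x -> ('X_i * p).@[x] = \sum_(k < d.+2) (h' k).@[x]].
Proof.
move=> hh h0 hp; pose a j : R := (j == i)%:R.
(* Degree k receives the raised component of degree k - 1 and the lowered one of degree k + 1; [a]
   is the i-th basis vector. *)
pose h' k : {mpoly R[n]} :=
  (if k is k'.+1 then harm_raise a k' (h k') else 0) +
  harm_coef R n k.+1 *: dir_deriv a (h k.+1).
have raise0 k : harm_raise a k 0 = 0.
  by rewrite /harm_raise /dir_deriv big1 ?mulr0 ?scaler0 ?subr0 // => j _; rewrite mderiv0 scaler0.
have dir0 : dir_deriv a 0 = 0.
  by rewrite /dir_deriv big1 // => j _; rewrite mderiv0 scaler0.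
exists h'; split.
- move=> k; apply: harm_homogD; last first.
    by apply: harm_homogZ; exact: (harm_dir_deriv _ (hh k.+1)).
  by case: k => [|k]; [exact: harm_homog0 | exact: harm_raiseP].
- move=> [|k] // dk; rewrite /h' (h0 k) // raise0 add0r h0 ?dir0 ?scaler0 //.
  by lia.
move=> x hx; rewrite mevalM mevalXU hp //.
have -> : x i = (linear_form a).@[x].
  rewrite eval_linear_form (bigD1 i) //= /a eqxx mul1r big1 ?addr0 //.
  by move=> j /negPf ->; rewrite mul0r.
rewrite mulr_sumr.
rewrite (eq_bigr _ (fun (k : 'I_d.+1) _ => harm_raise_eval a k (h k) hx)).
rewrite big_split /=.
under [RHS]eq_bigr do rewrite mevalD mevalZ.
rewrite [RHS]big_split /= [X in _ = X + _]big_ord_recl /= meval0 add0r; congr (_ + _).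
rewrite big_ord_recl (dir_deriv_homog0 _ (hh 0%N).1) meval0 mulr0 add0r.
rewrite [RHS]big_ord_recr [X in _ = X + _]big_ord_recr /= !(h0 d.+1, h0 d.+2) // dir0 meval0 !mulr0 !addr0.
by apply: eq_bigr.
Qed.

Lemma harm_decomp_monomial (m : 'X_{1..n}) :
  exists h : nat -> {mpoly R[n]},
    [/\ forall k, harm_homog k (h k), forall k, (mdeg m < k)%N -> h k = 0 &
      forall x, sphere n x -> 'X_[m].@[x] = \sum_(k < (mdeg m).+1) (h k).@[x]].
Proof.
move: {2}(mdeg m) (erefl (mdeg m)) => d; elim: d m => [|d IH] m dm.
  move/eqP: (dm); rewrite mdeg_eq0 => /eqP -> {m dm}.
  exists (fun k => if k == 0%N then 1 else 0); rewrite mdeg0; split.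
  - by case=> [|k]; [exact: harm_homog1 | exact: harm_homog0].
  - by case.
  - by move=> x _; rewrite big_ord1 mpolyX0.
have [i mi] : exists i, (U_(i) <= m)%MM.
  case: (pickP (fun i => m i != 0%N)) => [i mi|m0].
    by exists i; rewrite lep1mP.
  by move: dm; rewrite mdegE big1 // => i _; apply/eqP/negbFE/m0.
have em : m = (U_(i) + (m - U_(i)))%MM by rewrite addmC submK.
have dm' : mdeg (m - U_(i)) = d.
  by move: dm; rewrite {1}em mdegD mdeg1 add1n => -[].
have [h []] := IH _ dm'; rewrite dm' => h1 h2 h3.
have [h' [h1' h2' h3']] := harm_decomp_var i h1 h2 h3.
by exists h'; rewrite dm; split => // x hx; rewrite em mpolyXD h3'.
Qed.

(** One decomposition per monomial is fixed by choice, so that components depend linearly on the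
    coefficients of a polynomial and the two blocks of variables can be treated separately. *)
Lemma harm_decomp_monomials :
  exists h : 'X_{1..n} -> nat -> {mpoly R[n]}, forall m,
    [/\ forall k, harm_homog k (h m k), forall k, (mdeg m < k)%N -> h m k = 0 &
      forall d x, (mdeg m <= d)%N -> sphere n x ->
        'X_[m].@[x] = \sum_(k < d.+1) (h m k).@[x]].
Proof.
have [h hP] := choice harm_decomp_monomial; exists h => m.
have [h1 h2 h3] := hP m; split => // d x md hx; rewrite h3 //.
rewrite (big_ord_widen d.+1 (fun k => (h m k).@[x])) ?ltnS // big_mkcond.
by apply: eq_bigr => k _; case: ltnP => // mk; rewrite h2 // meval0.
Qed.

End HarmonicDecomposition.

(** * Gauss-Hermite quadrature *)

Section GaussRule.
Variable R : realType.

(** The moments of the standard normal law, through E x^(k+2) = (k + 1) E x^k. *)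
Fixpoint gauss_moment (k : nat) : R :=
  if k is k1.+1 then
    if k1 is k2.+1 then k1%:R * gauss_moment k2 else 0
  else 1.

Lemma gauss_momentS k : gauss_moment k.+1 = k%:R * gauss_moment k.-1.
Proof. by case: k => [|k] //=; rewrite mul0r. Qed.

(* Coordinates of x^k in the basis of orthonormal Hermite polynomials. *)
Fixpoint hermite_coord (k j : nat) : R :=
  if k is k'.+1 then
    (if j is j'.+1 then Num.sqrt j%:R * hermite_coord k' j' else 0) +
    Num.sqrt j.+1%:R * hermite_coord k' j.+1
  else (j == 0%N)%:R.

Lemma hermite_coordS k j : hermite_coord k.+1 j =
  (if j is j'.+1 then Num.sqrt j%:R * hermite_coord k j' else 0) +
  Num.sqrt j.+1%:R * hermite_coord k j.+1.
Proof. by []. Qed.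

Lemma hermite_coord_gt k j : (k < j)%N -> hermite_coord k j = 0.
Proof.
elim: k j => [|k IH] [|j] //= kj.
by rewrite !IH ?mulr0 ?addr0 //; lia.
Qed.

(** For the orthonormal Hermite polynomials h_(j+1)' = sqrt(j + 1) h_j, so this is (x^(k+1))' = (k +
    1) x^k read in coordinates. *)
Lemma hermite_coord_lower k j :
  Num.sqrt j.+1%:R * hermite_coord k.+1 j.+1 = k.+1%:R * hermite_coord k j.
Proof.
have sq i : Num.sqrt i%:R * Num.sqrt i%:R = i%:R :> R.
  by rewrite -expr2 sqr_sqrtr // ler0n.
elim: k j => [|k IH] j.
  by rewrite /= mulr0 addr0 mulrA sq; case: j => [|j] /=; rewrite ?mulr1 ?mulr0.
rewrite hermite_coordS mulrDr mulrA sq IH.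
have -> : k.+2%:R * hermite_coord k.+1 j =
    hermite_coord k.+1 j + k.+1%:R * hermite_coord k.+1 j.
  by rewrite -[in LHS]natr1 mulrDl mul1r addrC.
rewrite [X in _ = _ + _ * X]hermite_coordS.
case: j => [|j]; first by rewrite add0r mul1r mulrCA.
rewrite [X in _ = _ + X]mulrDr [X in _ = _ + (X + _)]mulrCA -(IH j) [X in _ = _ + (X + _)]mulrA sq.
rewrite [X in _ = _ + (_ + X)]mulrCA addrA.
congr (_ + _).
by rewrite -[j.+2%:R]natr1 mulrDl mul1r addrC.
Qed.

Lemma hermite_coord0 k : hermite_coord k 0 = gauss_moment k.
Proof.
elim/ltn_ind: k => -[|k] IH //; rewrite gauss_momentS hermite_coordS add0r.
case: k IH => [|k] IH; first by rewrite /= mulr0 mul0r.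
by rewrite hermite_coord_lower IH.
Qed.

(** Multiplication by x in the orthonormal Hermite basis, cut off after index D. *)
Definition hermite_jacobi D : 'M[R]_D.+1 :=
  \matrix_(i, j) ((i == j.+1 :> nat)%:R * Num.sqrt i%:R +
                  (j == i.+1 :> nat)%:R * Num.sqrt j%:R).

(** In k steps from index 0 one reaches index k at most, so for k <= D the cut-off is not felt. *)
Lemma hermite_jacobiX D k (j : 'I_D.+1) :
  (k <= D)%N -> (hermite_jacobi D ^+ k) ord0 j = hermite_coord k j.
Proof.
elim: k j => [|k IH] j kD; first by rewrite expr0 mxE eq_sym.
rewrite exprSr mxE.
under eq_bigr do rewrite IH ?(ltnW kD) // mxE mulrDr.
rewrite big_split hermite_coordS /= addrC; congr (_ + _).
  case: j => -[|j] jD /=.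
    by rewrite big1 // => i _; rewrite mul0r mulr0.
  rewrite (bigD1 (Ordinal (ltnW jD))) //= eqxx mul1r mulrC big1 ?addr0 //.
  move=> i /negPf ij; rewrite eqSS eq_sym.
  by move: ij; rewrite -val_eqE /= => ->; rewrite mul0r mulr0.
have [jD|Dj] := ltnP j D.
  rewrite (bigD1 (Ordinal (jD : j.+1 < D.+1)%N)) //= eqxx mul1r mulrC.
  rewrite big1 ?addr0 // => i /negPf.
  by rewrite -val_eqE /= => ->; rewrite mul0r mulr0.
rewrite hermite_coord_gt ?mulr0; last by lia.
rewrite big1 // => i _; case: eqP => [e|_]; last by rewrite mul0r mulr0.
by have := ltn_ord i; lia.
Qed.

Lemma hermitian_powers (C : numClosedFieldType) m (A : 'M[C]_m.+1) :
  A \is hermsymmx -> exists (P : 'M[C]_m.+1) (d : 'I_m.+1 -> C),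
    (forall l, d l \is Num.real) /\
    forall k i j, (A ^+ k) i j = \sum_l Num.conj (P l i) * d l ^+ k * P l j.
Proof.
move=> Aherm; have /mxOverP dreal := hermitian_spectral_diag_real Aherm.
have /orthomx_spectralP := hermitian_normalmx Aherm.
have := spectral_unitarymx A; have := spectral_unit A.
move: (spectralmx A) (spectral_diag A) dreal => P d dreal Pun Puni AE.
exists P, (d 0); split=> [l|k i j]; first exact: dreal.
have -> : A ^+ k = invmx P *m diag_mx (\row_i (d 0 i ^+ k)) *m P.
  elim: k => [|k IH].
    rewrite expr0 (_ : diag_mx _ = 1%:M) ?mulmx1 ?mulVmx //.
    by apply/matrixP => a b; rewrite !mxE.
  rewrite exprSr IH [X in _ * X]AE -!mulmxE !mulmxA mulmxK //.
  congr (_ *m _); rewrite -!mulmxA; congr (_ *m _); rewrite mulmx_diag.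
  by congr diag_mx; apply/rowP => a; rewrite !mxE exprSr.
rewrite mxE; apply: eq_bigr => l _.
by rewrite mul_mx_diag invmx_unitary // !mxE.
Qed.

(** Diagonalisation takes place over R[i]; squared moduli and the eigenvalues of a Hermitian matrix
    are real, which brings weights and nodes back to R. *)
Lemma symmetric_spectral_measure m (A : 'M[R]_m.+1) : A^T = A ->
  exists w theta : 'I_m.+1 -> R, (forall i, 0 <= w i) /\
    forall k, \sum_i w i * theta i ^+ k = (A ^+ k) ord0 ord0.
Proof.
move=> Asym; pose AC : 'M[R[i]]_m.+1 := map_mx (real_complex R) A.
have ACherm : AC \is hermsymmx.
  apply: realsym_hermsym.
    by apply/is_hermitianmxP; rewrite expr0 scale1r map_mx_id //;
       apply/matrixP => i j; rewrite !mxE -{1}Asym mxE.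
  by apply/mxOverP => i j; rewrite mxE; apply/complex_realP; eexists.
have [P [d [dreal AX]]] := hermitian_powers ACherm.
have /choice[w wE] i : exists w : R, w%:C%C = `|P i ord0| ^+ 2.
  by apply/ex_intro/RRe_real; rewrite realX ?normr_real.
have /choice[theta thetaE] i : exists t : R, t%:C%C = d i.
  by apply/ex_intro/RRe_real.
exists w, theta; split=> [i|k]; first by rewrite -ler0c wE exprn_ge0.
apply: (@complexI R).
have -> : ((A ^+ k) ord0 ord0)%:C%C = (AC ^+ k) ord0 ord0.
  by rewrite /AC -rmorphXn mxE.
rewrite AX raddf_sum; apply: eq_bigr => i _ /=.
have -> : ((w i * theta i ^+ k)%:C = (w i)%:C * (theta i)%:C ^+ k)%C.
  by rewrite rmorphM rmorphXn.
by rewrite wE thetaE normCK [RHS]mulrAC [X in _ = X * _]mulrC.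
Qed.

(* The nodes are the eigenvalues of the truncated Jacobi matrix and the weights the squared moduli of the first coordinates of its eigenvectors. *)
Lemma gauss_rule D : exists w theta : 'I_D.+1 -> R,
  (forall i, 0 <= w i) /\
  forall k, (k <= D)%N -> \sum_i w i * theta i ^+ k = gauss_moment k.
Proof.
have Jsym : (hermite_jacobi D)^T = hermite_jacobi D.
  by apply/matrixP => i j; rewrite !mxE addrC.
have [w [theta [w0 J]]] := symmetric_spectral_measure Jsym.
exists w, theta; split => // k kD.
by rewrite J -hermite_coord0 -(hermite_jacobiX (ord0 : 'I_D.+1) kD).
Qed.

End GaussRule.

(** * Cubature on the sphere *)

Section Evaluation.
Variables (R : realType) (n : nat).
Implicit Types (p f : {mpoly R[n]}) (x : 'I_n -> R).

Lemma meval_sum (I : Type) (r : seq I) (P : pred I) (F : I -> {mpoly R[n]}) x :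
  (\sum_(i <- r | P i) F i).@[x] = \sum_(i <- r | P i) (F i).@[x].
Proof. exact: (big_morph _ (mevalD x) (meval0 x)). Qed.

Lemma eval_sqnorm x : (sqnorm_poly R n).@[x] = \sum_(i < n) x i ^+ 2.
Proof.
by rewrite meval_sum; apply: eq_bigr => i _; rewrite rmorphXn /= mevalXU.
Qed.

Lemma homog_eval_scale k f c x : f \is k.-homog ->
  f.@[fun i => c * x i] = c ^+ k * f.@[x].
Proof.
move=> /dhomogP hf; rewrite !mevalE mulr_sumr.
rewrite big_seq [RHS]big_seq; apply: eq_bigr => m /hf hm.
rewrite mulrCA; congr (_ * _); rewrite -(hm : mdeg m = k) mdegE -prodrXr.
by rewrite -big_split /=; apply: eq_bigr => i _; rewrite exprMn.
Qed.

End Evaluation.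

(** * Gaussian means of polynomials in n variables *)

Section GaussCubature.
Variables (R : realType) (n D : nat) (w theta : 'I_D.+1 -> R).
Hypothesis rule : forall k, (k <= D)%N ->
  \sum_i w i * theta i ^+ k = gauss_moment R k.
Implicit Types (p f : {mpoly R[n]}).

Definition gauss_weight (phi : {ffun 'I_n -> 'I_D.+1}) : R :=
  \prod_(i < n) w (phi i).
Definition gauss_node (phi : {ffun 'I_n -> 'I_D.+1}) (i : 'I_n) : R :=
  theta (phi i).
Definition gauss_mean p : R := \sum_phi gauss_weight phi * p.@[gauss_node phi].

Fact gauss_mean_is_linear : linear_for *%R gauss_mean.
Proof.
move=> c p q; rewrite /gauss_mean mulr_sumr -big_split; apply: eq_bigr => phi _.
by rewrite mevalD mevalZ mulrDr mulrCA.
Qed.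

HB.instance Definition _ :=
  GRing.isLinear.Build R {mpoly R[n]} R *%R gauss_mean gauss_mean_is_linear.

Lemma gauss_mean_monomial (m : 'X_{1..n}) : (mdeg m <= D)%N ->
  gauss_mean 'X_[m] = \prod_(i < n) gauss_moment R (m i).
Proof.
move=> mD; have mi i : (m i <= D)%N.
  by apply: leq_trans mD; rewrite mdegE (bigD1 i) //= leq_addr.
under eq_bigr do rewrite -rule //.
rewrite bigA_distr_bigA /=; apply: eq_bigr => phi _.
by rewrite mevalX /gauss_weight -big_split.
Qed.

(** Gaussian integration by parts; on monomials it is the recursion of the moments. The size bound
    keeps ['X_i * p] within the degree of exactness D. *)
Lemma gauss_mean_varM i p : (msize p <= D)%N ->
  gauss_mean ('X_i * p) = gauss_mean p^`M(i).
Proof.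
move=> pD; rewrite (mpolyE p) mulr_sumr (linear_sum (mderiv i)) !linear_sum /= big_seq [RHS]big_seq.
apply: eq_bigr => m /msize_mdeg_lt mp; have mD := leq_trans mp pD.
rewrite -scalerAr mderivZ !linearZ /= mderivX linearZ /= -mpolyXD.
rewrite !gauss_mean_monomial ?mdegD ?mdeg1 //; last first.
  by apply: leq_trans (ltnW mD); exact: mdegB.
congr (_ * _); rewrite !(bigD1 i (P := xpredT)) //= mulrA; congr (_ * _).
  by rewrite mnmDE mnmBE mnm1E eqxx add1n gauss_momentS subn1.
apply: eq_bigr => j /negPf ji.
by rewrite mnmDE mnmBE mnm1E eq_sym ji add0n subn0.
Qed.

Lemma homog_msize_le k p : p \is k.-homog -> (msize p <= k.+1)%N.
Proof.
move=> /dhomogP hp; rewrite msizeE; apply/bigmax_leqP_seq => m /hp hm _.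
by rewrite ltnS -(hm : mdeg m = k).
Qed.

(** Euler's identity and integration by parts give k E f = sum_i E(X_i d_i f) = E(Delta f) = 0. *)
Lemma gauss_mean_harm k f : (0 < k <= D)%N -> harm_homog k f -> gauss_mean f = 0.
Proof.
case: k => // k /= kD [hf lf].
have : gauss_mean f *+ k.+1 = 0.
  rewrite -linearMn /= -(euler_homog hf) linear_sum /=.
  under eq_bigr => i _.
    rewrite gauss_mean_varM; last first.
      by apply: leq_trans kD; exact/homog_msize_le/(mderiv_homog i hf).
    over.
  by rewrite -linear_sum -/(laplacian f) lf linear0.
by move/eqP; rewrite mulrn_eq0 => /eqP.
Qed.

(** Integration by parts produces n p + sum_i X_i d_i p, and the sum is k p by Euler's identity.
    Iterated, this separates the radius from the direction. *)
Lemma gauss_mean_sqnormM k p : (k.+2 <= D)%N -> p \is k.-homog ->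
  gauss_mean (sqnorm_poly R n * p) = (n + k)%:R * gauss_mean p.
Proof.
move=> kD hp; rewrite /sqnorm_poly mulr_suml linear_sum /=.
under eq_bigr => i _.
  rewrite -mulrA gauss_mean_varM; last first.
    apply: leq_trans kD; apply: homog_msize_le; rewrite -(add1n k).
    by apply: dhomogM hp; rewrite dhomogX /= mdeg1.
  rewrite mderivM mderiv_var eqxx mul1r linearD /=.
  over.
rewrite big_split /= sumr_const card_ord -linear_sum /= (euler_homog hp).
by rewrite linearMn /= -mulrnDr mulr_natl.
Qed.

Lemma gauss_mean_sqnormXM j k p : (j.*2 + k <= D)%N -> p \is k.-homog ->
  gauss_mean (sqnorm_poly R n ^+ j * p) =
  (\prod_(i < j) (n + k + i.*2)%:R) * gauss_mean p.
Proof.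
move=> jD hp; elim: j jD => [|j IH] jD; first by rewrite expr0 mul1r big_ord0 mul1r.
rewrite exprS -mulrA (@gauss_mean_sqnormM (j.*2 + k)); first last.
- apply: dhomogM hp; rewrite -mul2n; apply: dhomogMn; exact: sqnorm_homog.
- by move: jD; rewrite doubleS.
rewrite IH; last by apply: leq_trans jD; rewrite doubleS; lia.
by rewrite big_ord_recr /= mulrCA mulrA addnA [(n + _ + k)%N]addnAC.
Qed.

End GaussCubature.

Section SphericalCubature.
Variables (R : realType) (n : nat).

(* By the last condition the measure integrates polynomials of degree at most D exactly as the uniform measure does. *)
Definition cubature D (I : finType) (w : I -> R) (pt : I -> 'I_n -> R) : Prop :=
  [/\ forall i, 0 <= w i, \sum_i w i = 1, forall i, sphere n (pt i) &
   forall k f, (0 < k <= D)%N -> harm_homog k f -> \sum_i w i * f.@[pt i] = 0].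

(** Gauss nodes theta are projected radially, their weights multiplied by |theta|^(2M). Antipodal
    pairs kill odd degrees; for k = 2j the sum is, up to a constant, the Gaussian mean of
    |X|^(2(M-j)) f, of degree 2M, hence a multiple of the mean of f, which is 0. *)
Lemma cubature_exists D : (0 < n)%N ->
  exists (I : finType) (w : I -> R) (pt : I -> 'I_n -> R), cubature D w pt.
Proof.
move=> n0; pose M := D.+1.
have [w [theta [w0 rule]]] := gauss_rule R M.*2.
pose T := {ffun 'I_n -> 'I_(M.*2).+1}.
pose sq (phi : T) : R := \sum_(i < n) gauss_node theta phi i ^+ 2.
have sq_ge0 phi : 0 <= sq phi by apply: sumr_ge0 => i _; rewrite sqr_ge0.
pose c : R := \sum_(phi : T) gauss_weight w phi * sq phi ^+ M.
have W0 (phi : T) : 0 <= gauss_weight w phi by apply: prodr_ge0 => i _.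
have meanE j k f : (j.*2 + k <= M.*2)%N -> f \is k.-homog ->
    \sum_(phi : T) gauss_weight w phi * (sq phi ^+ j * f.@[gauss_node theta phi]) =
    (\prod_(i < j) (n + k + i.*2)%:R) * gauss_mean w theta f.
  move=> jk hf; rewrite -(gauss_mean_sqnormXM rule) //.
  by apply: eq_bigr => phi _; rewrite mevalM rmorphXn /= eval_sqnorm.
have c_gt0 : 0 < c.
  have h1 : (1 : {mpoly R[n]}) \is 0.-homog by exact: dhomog1.
  have := meanE M 0%N 1; rewrite addn0 => /(_ (leqnn _) h1) E.
  have -> : c = \sum_(phi : T) gauss_weight w phi *
      (sq phi ^+ M * (1 : {mpoly R[n]}).@[gauss_node theta phi]).
    by apply: eq_bigr => phi _; rewrite meval1 mulr1.
  rewrite E -mpolyX0 (gauss_mean_monomial rule) ?mdeg0 //.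
  rewrite [X in _ * X]big1; last by move=> i _; rewrite mnm0E.
  by rewrite mulr1 prodr_gt0 // => i _; rewrite ltr0n; lia.
have [i0 _] : exists i : 'I_n, true by exists (Ordinal n0).
pose r (phi : T) := Num.sqrt (sq phi).
(* A node at the origin has no projection; the arbitrary point chosen for it gets weight 0. *)
pose pt (z : T * bool) (i : 'I_n) : R :=
  (-1) ^+ z.2 * (if sq z.1 == 0 then (i == i0)%:R
                 else (r z.1)^-1 * gauss_node theta z.1 i).
pose W (z : T * bool) : R := gauss_weight w z.1 * sq z.1 ^+ M / (c * 2).
exists ((T * bool)%type : finType), W, pt.
have sum_pair (F : T * bool -> R) :
    \sum_z F z = \sum_phi (F (phi, true) + F (phi, false)).
  rewrite -(eq_bigr _ (fun z _ => congr1 F (esym (surjective_pairing z)))).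
  rewrite -(pair_bigA _ (fun phi b => F (phi, b))) /=.
  by apply: eq_bigr => phi _; rewrite big_bool.
split.
- move=> z; rewrite /W divr_ge0 ?mulr_ge0 ?exprn_ge0 //; exact: ltW.
- rewrite sum_pair /W /=.
  have E (a : R) : a / (c * 2) + a / (c * 2) = a / c by field; exact: lt0r_neq0.
  under eq_bigr do rewrite E.
  by rewrite -mulr_suml divff // lt0r_neq0.
- move=> [phi b]; rewrite /sphere /pt /=.
  under eq_bigr do rewrite exprMn -exprM mulnC exprM sqrrN expr1n expr1n mul1r.
  case: eqP => [_|/eqP s0].
    rewrite (bigD1 i0) //= eqxx expr1n big1 ?addr0 // => i /negPf ->.
    by rewrite expr0n.
  under eq_bigr do rewrite exprMn.
  by rewrite -mulr_sumr exprVn sqr_sqrtr // mulVf.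
move=> k f /andP[k0 kD] hf; have [hh _] := hf.
rewrite sum_pair /W /=.
have evalN phi b : f.@[pt (phi, b)] = ((-1) ^+ b) ^+ k * f.@[pt (phi, false)].
  rewrite -(homog_eval_scale _ _ hh); apply: meval_eq => i.
  by rewrite /pt /= expr0 mul1r.
under eq_bigr do rewrite -mulrDr (evalN _ true).
case: (boolP (odd k)) => ok.
  by rewrite big1 // => phi _; rewrite expr1 -signr_odd ok expr1 mulN1r addNr mulr0.
pose j := k./2; have kE : k = j.*2 by rewrite -[LHS]odd_double_half (negPf ok).
have jM : (0 < M - j)%N by rewrite /M /j; lia.
have E phi : gauss_weight w phi * sq phi ^+ M * f.@[pt (phi, false)] =
    gauss_weight w phi * (sq phi ^+ (M - j) * f.@[gauss_node theta phi]).
  rewrite -mulrA; congr (_ * _).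
  have -> : sq phi ^+ M = sq phi ^+ (M - j) * sq phi ^+ j.
    by rewrite -exprD subnK //; lia.
  have [s0|s0] := eqVneq (sq phi) 0; first by rewrite s0 !expr0n gtn_eqF // !mul0r.
  rewrite -mulrA; congr (_ * _).
  have -> : f.@[pt (phi, false)] = (r phi)^-1 ^+ k * f.@[gauss_node theta phi].
    rewrite -(homog_eval_scale _ _ hh); apply: meval_eq => i.
    by rewrite /pt /= expr0 mul1r (negPf s0).
  rewrite mulrA kE -muln2 mulnC exprM exprVn sqr_sqrtr // -exprMn mulfV //.
  by rewrite expr1n mul1r.
have F phi : gauss_weight w phi * sq phi ^+ M / (c * 2) *
    (((-1) ^+ true) ^+ k * f.@[pt (phi, false)] + f.@[pt (phi, false)]) =
    c^-1 * (gauss_weight w phi * (sq phi ^+ (M - j) * f.@[gauss_node theta phi])).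
  rewrite expr1 -signr_odd (negPf ok) expr0 mul1r -E.
  by field; exact: lt0r_neq0.
rewrite (eq_bigr _ (fun phi _ => F phi)) -mulr_sumr (meanE _ k) //; last by lia.
rewrite (@gauss_mean_harm _ _ _ _ _ rule k) ?mulr0 //.
by rewrite k0 /M; lia.
Qed.

End SphericalCubature.

(** * The Funk-Hecke formula and zonal polynomials *)

Section FunkHecke.
Variables (R : realType) (n : nat).
Hypothesis n_gt0 : (0 < n)%N.
Implicit Types (g h : {poly R}) (x y : 'I_n -> R).

Definition dotp x y : R := \sum_(i < n) x i * y i.

(** For f in H_k and a = x, Euler's identity turns the lowered part of (a . x) f into [lower_coef k]
    times f(x); the raised part carries the remaining 1 - [lower_coef k]. *)
Definition lower_coef (k : nat) : R := k%:R / (n + k.*2 - 2)%:R.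

Lemma lower_coef0 : lower_coef 0 = 0. Proof. by rewrite /lower_coef mul0r. Qed.

Lemma lower_coefS_neq0 k : lower_coef k.+1 != 0.
Proof. by rewrite /lower_coef mulf_neq0 ?invr_neq0 // pnatr_eq0; lia. Qed.

(* The eigenvalue on H_k of the convolution operator with kernel (x . y)^m. *)
Fixpoint monomial_eigen (m k : nat) : R :=
  if m is m'.+1 then
    (1 - lower_coef k) * monomial_eigen m' k.+1 +
    lower_coef k * monomial_eigen m' k.-1
  else (k == 0%N)%:R.

Definition eigenval (k : nat) g : R :=
  \sum_(i < size g) g`_i * monomial_eigen i k.

Lemma eigenval_wide N k g : (size g <= N)%N ->
  eigenval k g = \sum_(i < N) g`_i * monomial_eigen i k.
Proof.
move=> gN; rewrite /eigenval (big_ord_widen N (fun i => g`_i * monomial_eigen i k)) //.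
rewrite big_mkcond; apply: eq_bigr => i _; case: ltnP => // gi.
by rewrite nth_default ?mul0r.
Qed.

Fact eigenval_is_linear k : linear_for *%R (eigenval k).
Proof.
move=> c g h; pose N := maxn (size g) (size h).
have gN : (size g <= N)%N by rewrite leq_maxl.
have hN : (size h <= N)%N by rewrite leq_maxr.
rewrite !(@eigenval_wide N) //; last first.
  by rewrite (leq_trans (size_polyD _ _)) // geq_max hN (leq_trans (size_scale_leq _ _)).
rewrite mulr_sumr -big_split; apply: eq_bigr => i _.
by rewrite coefD coefZ mulrDl mulrA.
Qed.

HB.instance Definition _ k :=
  GRing.isLinear.Build R {poly R} R *%R (eigenval k) (eigenval_is_linear k).

Lemma eigenvalXM k g : eigenval k ('X * g) =
  (1 - lower_coef k) * eigenval k.+1 g + lower_coef k * eigenval k.-1 g.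
Proof.
have gX : (size ('X * g)%R <= (size g).+1)%N.
  by rewrite (leq_trans (size_polyMleq _ _)) // size_polyX.
rewrite (eigenval_wide _ gX) big_ord_recl coefXM mul0r add0r.
rewrite /eigenval !mulr_sumr -big_split; apply: eq_bigr => i _.
by rewrite coefXM /= mulrDr !(mulrCA g`_i).
Qed.

Lemma eigenval1 k : eigenval k 1 = (k == 0%N)%:R.
Proof. by rewrite /eigenval size_poly1 big_ord1 coef1 mul1r. Qed.

Section Cubature.
Variables (D : nat) (I : finType) (w : I -> R) (pt : I -> 'I_n -> R).
Hypothesis cub : cubature D w pt.

Lemma funk_hecke_monomial m k f x : (m + k <= D)%N -> sphere n x ->
  harm_homog k f ->
  \sum_i w i * (dotp x (pt i) ^+ m * f.@[pt i]) = monomial_eigen m k * f.@[x].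
Proof.
have [_ w1 wS wD] := cub.
elim: m k f => [|m IH] k f mk hx hf.
  under eq_bigr do rewrite expr0 mul1r.
  case: k => [|k] in mk hf *; last by rewrite (wD k.+1) //= mul0r.
  have /msize1_polyC -> := homog_msize_le hf.1.
  under eq_bigr do rewrite mevalC.
  by rewrite -mulr_suml w1 !mul1r mevalC.
have [hh _] := hf.
have E i : w i * (dotp x (pt i) ^+ m.+1 * f.@[pt i]) =
   w i * (dotp x (pt i) ^+ m * (harm_raise x k f).@[pt i]) +
   harm_coef R n k * (w i * (dotp x (pt i) ^+ m * (dir_deriv x f).@[pt i])).
  have -> : dotp x (pt i) ^+ m.+1 * f.@[pt i] = dotp x (pt i) ^+ m *
      ((linear_form x).@[pt i] * f.@[pt i]).
    by rewrite eval_linear_form exprSr mulrA.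
  by rewrite (harm_raise_eval _ k _ (wS i)); ring.
rewrite (eq_bigr _ (fun i _ => E i)) big_split /= -mulr_sumr.
rewrite (IH k.+1 (harm_raise x k f)) //; [|by lia|exact: harm_raiseP].
rewrite (IH k.-1 (dir_deriv x f)) //; [|by lia|exact: harm_dir_deriv].
have := harm_raise_eval x k f hx.
rewrite eval_linear_form (eval_dir_deriv _ hh).
have -> : \sum_(i < n) x i * x i = 1 by rewrite -[RHS]hx; apply: eq_bigr.
rewrite mul1r /= => /esym/(canRL (addrK _)) ->.
by rewrite /harm_coef /lower_coef; ring.
Qed.

Lemma funk_hecke g k f x : (size g + k <= D.+1)%N -> sphere n x ->
  harm_homog k f ->
  \sum_i w i * (g.[dotp x (pt i)] * f.@[pt i]) = eigenval k g * f.@[x].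
Proof.
move=> gk hx hf; rewrite /eigenval mulr_suml.
under eq_bigr => i _ do rewrite horner_coef mulr_suml mulr_sumr.
rewrite exchange_big /=; apply: eq_bigr => j _.
have jk : (j + k <= D)%N 
  by rewrite -ltnS; apply: leq_trans gk; rewrite -addSn leq_add2r ltn_ord.
rewrite -mulrA -(funk_hecke_monomial jk hx hf).
by rewrite mulr_sumr; apply: eq_bigr => i _; ring.
Qed.

End Cubature.

(** Consecutive kernels are paired to make the two-step recursion structural. It solves s Z_(j+1) =
    [lower_coef j.+2] Z_(j+2) + (1 - [lower_coef j]) Z_j, a recurrence of Gegenbauer type. *)
Fixpoint zonal_pair (j : nat) : {poly R} * {poly R} :=
  if j is j'.+1 then
    let: (z0, z1) := zonal_pair j' in
    (z1, (lower_coef j'.+2)^-1 *: ('X * z1 - (1 - lower_coef j') *: z0))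
  else (1, (lower_coef 1)^-1 *: 'X).

(* The reproducing kernel of H_j, as a function of x . y. *)
Definition zonal j : {poly R} := (zonal_pair j).1.

Lemma zonal0 : zonal 0 = 1. Proof. by []. Qed.

Lemma zonal1 : zonal 1 = (lower_coef 1)^-1 *: 'X. Proof. by []. Qed.

Lemma zonalSS j : zonal j.+2 =
  (lower_coef j.+2)^-1 *: ('X * zonal j.+1 - (1 - lower_coef j) *: zonal j).
Proof. by rewrite /zonal /=; case: (zonal_pair j). Qed.

Lemma zonal_ind (P : nat -> Prop) :
  P 0 -> P 1 -> (forall j, P j -> P j.+1 -> P j.+2) -> forall j, P j.
Proof.
move=> P0 P1 PS j; suff: P j /\ P j.+1 by case.
by elim: j => [|j [Pj PSj]]; split => //; apply: PS.
Qed.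

Lemma size_zonal j : (size (zonal j) <= j.+1)%N.
Proof.
elim/zonal_ind: j => [||j s0 s1]; first by rewrite zonal0 size_poly1.
  by rewrite zonal1 (leq_trans (size_scale_leq _ _)) // size_polyX.
rewrite zonalSS (leq_trans (size_scale_leq _ _)) //.
rewrite (leq_trans (size_polyD _ _)) // geq_max size_polyN; apply/andP; split.
  by rewrite (leq_trans (size_polyMleq _ _)) // size_polyX.
by rewrite (leq_trans (size_scale_leq _ _)) // ltnW // ltnS leqW.
Qed.

(** The reproducing property: the recursion of the kernels is the transpose of the action of s on
    eigenvalues in [eigenvalXM]. *)
Lemma eigenval_zonal l j : eigenval l (zonal j) = (l == j)%:R.
Proof.
elim/zonal_ind: j l => [l||j IH0 IH1 l]; first by rewrite zonal0 eigenval1.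
  move=> l; rewrite zonal1 linearZ /= -['X]mulr1 eigenvalXM !eigenval1 mulr0 add0r.
  case: l => [|[|l]] /=; rewrite ?lower_coef0 ?mul0r ?mulr0 //.
  by rewrite mulr1 mulVf // lower_coefS_neq0.
rewrite zonalSS linearZ linearB linearZ /= eigenvalXM !IH0 !IH1 eqSS.
have -> : (1 - lower_coef l) * (l == j)%:R = (1 - lower_coef j) * (l == j)%:R.
  by case: eqP => [->|]; rewrite ?mulr0.
rewrite addrAC subrr add0r; case: l => [|l] /=; first by rewrite lower_coef0 mul0r mulr0.
rewrite eqSS; case: eqP => [->|_]; last by rewrite !mulr0.
by rewrite mulr1 mulVf // lower_coefS_neq0.
Qed.

(* The dimension of H_j; edge_weight j is 'C(n + j - 2, j), and the multiplication by s is the random walk on the naturals with these conductances. *)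
Fixpoint harm_dim (j : nat) : R :=
  if j is j'.+1 then harm_dim j' * (1 - lower_coef j') / lower_coef j else 1.
Definition edge_weight j : R := harm_dim j * (1 - lower_coef j).

Lemma harm_dim0 : harm_dim 0 = 1. Proof. by []. Qed.

Lemma harm_dimSE j : harm_dim j.+1 = edge_weight j / lower_coef j.+1.
Proof. by []. Qed.

Lemma harm_dimS_lower j : harm_dim j.+1 * lower_coef j.+1 = edge_weight j.
Proof. by rewrite harm_dimSE divfK // lower_coefS_neq0. Qed.

Lemma harm_dimS j : harm_dim j.+1 = edge_weight j.+1 + edge_weight j.
Proof. by rewrite -(harm_dimS_lower j) /edge_weight; ring. Qed.

(** The integral of Z_j g is the eigenvalue of g on H_j times Z_j(1) = dim H_j. The induction rests
    on [harm_dimS_lower]: an edge has the same conductance seen from both ends. *)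
Lemma eigenval0_zonalM j g : eigenval 0 (zonal j * g) = harm_dim j * eigenval j g.
Proof.
elim/zonal_ind: j g => [g|g|j IH0 IH1 g]; first by rewrite zonal0 harm_dim0 !mul1r.
  rewrite zonal1 -scalerAl linearZ /= eigenvalXM lower_coef0 subr0 !mul1r mul0r addr0.
  by rewrite mulrC.
have -> : zonal j.+2 * g = (lower_coef j.+2)^-1 *:
    (zonal j.+1 * ('X * g) - (1 - lower_coef j) *: (zonal j * g)).
  by rewrite zonalSS -scalerAl mulrBl -scalerAl mulrA ['X * _]mulrC.
rewrite harm_dimSE linearZ linearB linearZ /= IH1 IH0 eigenvalXM -[j.+1.-1]/j.
rewrite [harm_dim j.+1 * (_ + _)]mulrDr.
have -> : harm_dim j.+1 * (lower_coef j.+1 * eigenval j g) =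
    (1 - lower_coef j) * (harm_dim j * eigenval j g).
  by rewrite mulrA harm_dimS_lower /edge_weight; ring.
rewrite addrK mulrA /edge_weight; ring.
Qed.

End FunkHecke.

(** * The kernel and its eigenvalues *)

Section KernelGap.
Variables (R : realType) (n : nat).
Hypothesis n_gt0 : (0 < n)%N.
Local Notation e := (@edge_weight R n).

Lemma edge_weight0 : e 0 = 1.
Proof. by rewrite /edge_weight lower_coef0 subr0 mulr1. Qed.

Lemma edge_weightS j : j.+1%:R * e j.+1 = (n%:R - 1 + j%:R) * e j.
Proof.
have c0 : (n + j.*2)%:R != 0 :> R by rewrite pnatr_eq0; lia.
have j0 : j.+1%:R != 0 :> R by rewrite pnatr_eq0.
rewrite {1}/edge_weight harm_dimSE /lower_coef.
have -> : (n + j.+1.*2 - 2 = n + j.*2)%N by lia.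
have E : (n + j.*2)%:R = n%:R + j%:R + j%:R :> R by rewrite natrD -addnn natrD addrA.
rewrite invf_div E in c0 *; rewrite -[j.+1%:R]natr1 in j0 *.
by field; rewrite c0 j0.
Qed.

Lemma edge_weight_ge0 j : 0 <= e j.
Proof.
elim: j => [|j IH]; first by rewrite edge_weight0.
rewrite -(pmulr_rge0 _ (ltr0Sn R j)) edge_weightS mulr_ge0 //.
by rewrite addr_ge0 ?ler0n // subr_ge0 ler1n.
Qed.

(** S turns out to be the Dirichlet form of the kernel ([gap_kernel]) and G its squared norm
    ([norm_kernel]). The closed forms below, by induction on t, express P and G - S as multiples of
    S. *)
Let S t : R := \sum_(j < t.+1) e j.
Let P t : R := \sum_(j < t.+1) (t.+1 - j)%:R * e j.
Let G t : R := \sum_(j < t.+1) e j * ((t.+1 - j)%:R ^+ 2 + (t - j)%:R ^+ 2).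

Let Sge1 t : 1 <= S t.
Proof.
rewrite /S big_ord_recl edge_weight0 lerDl sumr_ge0 // => j _.
exact: edge_weight_ge0.
Qed.

Let SS t : S t.+1 = S t + e t.+1.
Proof. by rewrite /S big_ord_recr. Qed.

Let PS t : P t.+1 = P t + S t.+1.
Proof.
rewrite /P big_ord_recr /= [S _]big_ord_recr /= subSnn mul1r addrA.
congr (_ + _); rewrite /S -big_split; apply: eq_bigr => j _.
by rewrite subSn ?(ltnW (ltn_ord j)) // -natr1 mulrDl mul1r.
Qed.

Let GS t : G t.+1 = G t + 4 * P t + e t.+1.
Proof.
rewrite /G big_ord_recr /= subSnn subnn expr1n expr0n addr0 mulr1; congr (_ + _).
rewrite /P mulr_sumr -big_split; apply: eq_bigr => j _ /=.
have jt : (j <= t)%N by rewrite -ltnS.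
rewrite !(@subSn j) ?(leqW jt) // -!natr1; ring.
Qed.

Let S_closed t : (n%:R - 1) * S t = (t.+1)%:R * e t.+1.
Proof.
elim: t => [|t IH].
  by rewrite /S big_ord1 edge_weightS addr0 mulrC.
rewrite SS mulrDr IH -mulrDl [RHS]edge_weightS; congr (_ * _); ring.
Qed.

Let S_next t : t.+1%:R * S t.+1 = (n + t)%:R * S t.
Proof.
rewrite SS mulrDr -S_closed -mulrDl; congr (_ * _).
by rewrite natrD -natr1; ring.
Qed.

Let P_closed t : n%:R * P t = (n + t)%:R * S t.
Proof.
elim: t => [|t IH]; first by rewrite /P /S !big_ord1 mul1r addn0.
by rewrite PS mulrDr IH -S_next -mulrDl -natrD addnC addnS.
Qed.

Let G_closed t : (n.+1)%:R * (G t - S t) = 4 * t%:R * P t.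
Proof.
elim: t => [|t IH].
  by rewrite /G /S !big_ord1 expr1n expr0n addr0 mulr1 subrr !mulr0 mul0r.
rewrite GS SS PS.
have -> : G t + 4 * P t + e t.+1 - (S t + e t.+1) = (G t - S t) + 4 * P t by ring.
rewrite mulrDr IH [in RHS]mulrDr -![4 * _ * _]mulrA.
rewrite S_next -P_closed -natr1 -[t.+1%:R]natr1; ring.
Qed.

(** The coefficients are the eigenvalues: a ramp down to 0 whose neighbouring values differ by one,
    which keeps the Dirichlet form summable in closed form. *)
Definition kernel_root t : {poly R} :=
  \sum_(j < t.+1) (t.+1 - j)%:R *: zonal R n j.

Lemma size_kernel_root t : (size (kernel_root t) <= t.+1)%N.
Proof.
rewrite /kernel_root (leq_trans (size_sum _ _ _)) //; apply/bigmax_leqP => j _.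
by rewrite (leq_trans (size_scale_leq _ _)) // (leq_trans (size_zonal _ _ _)).
Qed.

Lemma eigenval_kernel_root t l : eigenval n l (kernel_root t) = (t.+1 - l)%:R.
Proof.
rewrite /kernel_root linear_sum /=.
under eq_bigr do rewrite linearZ /= eigenval_zonal //.
have [lt|tl] := ltnP l t.+1.
  rewrite (bigD1 (Ordinal lt)) //= eqxx mulr1 big1 ?addr0 // => j /negPf.
  by rewrite -val_eqE eq_sym /= => ->; rewrite mulr0.
rewrite big1 => [|j _]; first by apply/eqP; rewrite eq_sym pnatr_eq0 subn_eq0.
by rewrite gtn_eqF ?mulr0 // (leq_trans (ltn_ord j)).
Qed.

Lemma eigenval0_kernel_rootM t g : eigenval n 0 (kernel_root t * g) =
  \sum_(j < t.+1) (t.+1 - j)%:R * (harm_dim R n j * eigenval n j g).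
Proof.
rewrite /kernel_root mulr_suml linear_sum; apply: eq_bigr => j _.
by rewrite /= -scalerAl linearZ /= eigenval0_zonalM.
Qed.

(** Abel summation against the ramp; the 0 at j = 0 stands for the missing edge below vertex 0. *)
Let sum_by_parts t : \sum_(j < t.+1)
    (t.+1 - j)%:R * (e j - (if val j is j'.+1 then e j' else 0)) = S t.
Proof.
pose H t := \sum_(j < t.+1)
  (t.+1 - j)%:R * (e j - (if val j is j'.+1 then e j' else 0)).
have T u : \sum_(j < u.+1) (e j - (if val j is j'.+1 then e j' else 0)) = e u.
  by elim: u => [|u IH]; rewrite ?big_ord1 ?subr0 // big_ord_recr IH /= addrC subrK.
rewrite -/(H t); elim: t => [|t IH]; first by rewrite /H /S !big_ord1 mul1r subr0.
rewrite SS -IH -T.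
rewrite /H big_ord_recr [X in _ = _ + X]big_ord_recr /= subSnn mul1r [RHS]addrA; congr (_ + _).
rewrite -big_split; apply: eq_bigr => j _ /=.
by rewrite subSn ?(ltnW (ltn_ord j)) // -natr1 mulrDl mul1r.
Qed.

(** Since [harm_dim j] is the sum of the weights of the edges at j, each edge collects the squared
    ramp values at both its ends. *)
Let norm_kernel t : eigenval n 0 (kernel_root t ^+ 2) = G t.
Proof.
rewrite expr2 eigenval0_kernel_rootM.
under eq_bigr do rewrite eigenval_kernel_root mulrCA -expr2.
have -> : G t = \sum_(j < t.+1) e j * (t.+1 - j)%:R ^+ 2 +
    \sum_(j < t) e j * (t - j)%:R ^+ 2.
  rewrite /G; under eq_bigr do rewrite mulrDr.
  by rewrite big_split /= [X in _ + X]big_ord_recr /= subnn expr0n mulr0 addr0.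
rewrite big_ord_recl [X in _ = X + _]big_ord_recl -addrA.
congr (_ + _); first by rewrite /= edge_weight0.
rewrite -big_split; apply: eq_bigr => j _.
by rewrite !lift0 harm_dimS // subSS mulrDl.
Qed.

(** For j <= t, with r the ramp, the edges at j contribute e_j (r_j - r_(j+1)) + e_(j-1) (r_j -
    r_(j-1)) = e_j - e_(j-1). *)
Let gap_kernel t :
  eigenval n 0 (kernel_root t ^+ 2) - eigenval n 0 ('X * kernel_root t ^+ 2) = S t.
Proof.
rewrite expr2 mulrCA !eigenval0_kernel_rootM -sumrB -sum_by_parts.
have E j : (j <= t)%N -> harm_dim R n j * eigenval n j (kernel_root t) -
    harm_dim R n j * eigenval n j ('X * kernel_root t) =
    e j - (if j is j'.+1 then e j' else 0).
  move=> jt; rewrite eigenvalXM !eigenval_kernel_root -mulrBr subSS.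
  have -> : (t.+1 - j)%:R = (t - j)%:R + 1 :> R by rewrite subSn ?natr1.
  case: j jt => [|j] jt.
    by rewrite lower_coef0 harm_dim0 edge_weight0 mul0r; ring.
  rewrite -(harm_dimS_lower _ n_gt0 j) /edge_weight -[j.+1.-1]/j.
  have -> : (t.+1 - j)%:R = (t - j.+1)%:R + 1 + 1 :> R.
    by rewrite !natr1 -!subSn // (leqW jt).
  by move: (harm_dim R n j.+1) (lower_coef R n j.+1) => a b; ring.
by apply: eq_bigr => j _; rewrite -mulrBr E // -ltnS.
Qed.

(** The closed forms give n (n + 1) (G - S) = 4 t (n + t) S, hence 2 t^2 S <= n^2 G as n >= 1. *)
Lemma kernel_gap t : exists u : {poly R}, [/\ (size u <= t.+1)%N,
  0 < eigenval n 0 (u ^+ 2) &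
  2 * t%:R ^+ 2 * (eigenval n 0 (u ^+ 2) - eigenval n 0 ('X * u ^+ 2)) <=
  n%:R ^+ 2 * eigenval n 0 (u ^+ 2)].
Proof.
exists (kernel_root t); rewrite gap_kernel norm_kernel.
split; first exact: size_kernel_root.
all: have S1 := Sge1 t; have S0 : 0 <= S t by apply: le_trans S1.
all: have GE : n%:R * (n%:R + 1) * (G t - S t) = 4 * t%:R * ((n + t)%:R * S t).
1,3: by rewrite -P_closed natr1 -mulrA G_closed; ring.
- have n0 : 0 < n%:R * (n%:R + 1) :> R by rewrite mulr_gt0 ?ltr0n // natr1 ltr0n.
  rewrite -(subrK (S t) (G t)) ltr_wpDl ?(lt_le_trans ltr01) //.
  by rewrite -(pmulr_rge0 _ n0) GE !mulr_ge0 ?ler0n.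
have n0 : 0 < n%:R * (n%:R + 1) :> R by rewrite mulr_gt0 ?ltr0n // natr1 ltr0n.
rewrite -(ler_pM2l n0).
have -> : n%:R * (n%:R + 1) * (n%:R ^+ 2 * G t) =
  n%:R ^+ 2 * (n%:R * (n%:R + 1) * (G t - S t) + n%:R * (n%:R + 1) * S t) by ring.
rewrite GE natrD -subr_ge0.
have -> : n%:R ^+ 2 * (4 * t%:R * ((n%:R + t%:R) * S t) +
  n%:R * (n%:R + 1) * S t) - n%:R * (n%:R + 1) * (2 * t%:R ^+ 2 * S t) =
  S t * n%:R * (2 * t%:R ^+ 2 * (n%:R - 1) + 4 * t%:R * n%:R ^+ 2 + n%:R ^+ 2 * (n%:R + 1)) :> R.
  ring.
have : 0 <= n%:R - 1 :> R by rewrite subr_ge0 ler1n.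
move: (n%:R - 1) => a a0.
by rewrite !mulr_ge0 ?ler0n // !addr_ge0 ?mulr_ge0 ?exprn_ge0 ?addr_ge0 ?ler0n.
Qed.

End KernelGap.

(** Cauchy-Schwarz in the plane: p . q <= |p| |q| <= k |p|^2. *)
Lemma dot2_le (R : realFieldType) (p1 p2 q1 q2 k : R) : 0 <= k ->
  q1 ^+ 2 + q2 ^+ 2 <= k ^+ 2 * (p1 ^+ 2 + p2 ^+ 2) ->
  p1 * q1 + p2 * q2 <= k * (p1 ^+ 2 + p2 ^+ 2).
Proof.
rewrite le_eqVlt => /orP[/eqP <-|k0 h].
  rewrite expr0n !mul0r => h.
  have /andP[] : (q1 == 0) && (q2 == 0).
    by rewrite -(sqrf_eq0 q1) -(sqrf_eq0 q2) -paddr_eq0 ?sqr_ge0 // eq_le h addr_ge0 ?sqr_ge0.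
  by move=> /eqP-> /eqP->; rewrite !mulr0 addr0.
rewrite -(ler_pM2l k0).
have := sqr_ge0 (k * p1 - q1); have := sqr_ge0 (k * p2 - q2).
nra.
Qed.

(** * Comparison of all eigenvalues with the first gap *)

Section EigenvalueBounds.
Variables (R : realType) (n : nat) (i j : 'I_n).
Hypothesis neq_ij : i != j.
Implicit Types x : 'I_n -> R.

(* Real and imaginary parts of (X_i + sqrt(-1) X_j)^k. *)
Fixpoint complex_power (k : nat) : {mpoly R[n]} * {mpoly R[n]} :=
  if k is k'.+1 then
    let: (a, b) := complex_power k' in ('X_i * a - 'X_j * b, 'X_j * a + 'X_i * b)
  else (1, 0).

(** The Cauchy-Riemann equations are carried along because they cancel the first-order terms of both
    Laplacians. *)
Lemma complex_powerP k : let: (a, b) := complex_power k in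
  [/\ a \is k.-homog, b \is k.-homog, laplacian a = 0, laplacian b = 0 &
   a^`M(i) = b^`M(j) /\ a^`M(j) = - b^`M(i)].
Proof.
elim: k => [|k] /=.
  split; [exact: dhomog1 | exact: rpred0 | | exact: linear0 |].
    by rewrite /laplacian big1 // => l _; rewrite -mpolyC1 mderivC mderiv0.
  by rewrite -mpolyC1 !(mderivC, mderiv0) oppr0.
case: (complex_power k) => a b [ha hb la lb [c1 c2]].
have vh l (p : {mpoly R[n]}) : p \is k.-homog -> 'X_l * p \is k.+1.-homog.
  by move=> hp; rewrite -(add1n k); apply: dhomogM hp; rewrite dhomogX /= mdeg1.
split; [by apply: rpredB; apply: vh | by apply: rpredD; apply: vh | | |].
- by rewrite linearB /= !laplacian_varM la lb !mulr0 !add0r c1 subrr.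
- by rewrite linearD /= !laplacian_varM la lb !mulr0 !add0r c2 mulNrn addNr.
have ji : (j == i) = false by rewrite eq_sym (negPf neq_ij).
rewrite !mderivB !mderivD !mderivM !mderiv_var !eqxx (negPf neq_ij) ji c1 c2.
by rewrite /= !mulr1n !mulr0n; split; ring.
Qed.

Lemma complex_power_bounds k x : sphere n x ->
  let: (a, b) := complex_power k in
  a.@[x] <= 1 /\ 1 - a.@[x] <= k%:R ^+ 2 * (1 - x i).
Proof.
move=> hx; set s := x i; set y := x j.
have sy1 : s ^+ 2 + y ^+ 2 <= 1.
  rewrite -hx (bigD1 i) //= (bigD1 j) 1?eq_sym //= addrA lerDl.
  by apply: sumr_ge0 => l _; rewrite sqr_ge0.
(* With z = s + i y, so that |z| <= 1, the induction also carries |z^k| <= 1 and |1 - z^k| <= k |1 -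
   z|. *)
suff: let: (a, b) := complex_power k in
    [/\ a.@[x] ^+ 2 + b.@[x] ^+ 2 <= 1,
     (1 - a.@[x]) ^+ 2 + b.@[x] ^+ 2 <= k%:R ^+ 2 * ((1 - s) ^+ 2 + y ^+ 2) &
     1 - a.@[x] <= k%:R ^+ 2 * (1 - s)].
  case: (complex_power k) => a b [h1 _ h3]; split => //.
  by move: h1; move: (a.@[x]) (b.@[x]) => u v h1; nra.
elim: k => [|k] /=.
  by rewrite meval1 meval0 subrr !expr0n /= !mul0r addr0 expr1n; split.
case: (complex_power k) => a b [].
rewrite mevalB mevalD !mevalM !mevalXU -/s -/y.
move: (a.@[x]) (b.@[x]) => u v h1 h2 h3.
have k0 : 0 <= k%:R :> R by rewrite ler0n.
have X2 : (1 - s) ^+ 2 + y ^+ 2 <= 2 * (1 - s) by nra.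
(* For w = z^k, the real part of the last term of 1 - z w = (1 - z) + (1 - w) - (1 - z) (1 - w). *)
have cross : - ((1 - s) * (1 - u) - y * v) <= k%:R * ((1 - s) ^+ 2 + y ^+ 2).
  have -> : - ((1 - s) * (1 - u) - y * v) = (1 - s) * (u - 1) + y * v by ring.
  by apply: dot2_le => //; rewrite -sqrrN opprB.
(* The inner product of the two terms of 1 - z w = (1 - z) + z (1 - w). *)
have cross' : (1 - s) * (s * (1 - u) + y * v) + y * (s * v - y * (1 - u)) <=
    k%:R * ((1 - s) ^+ 2 + y ^+ 2).
  apply: dot2_le => //; apply: le_trans h2.
  have -> : (s * (1 - u) + y * v) ^+ 2 + (s * v - y * (1 - u)) ^+ 2 =
    (s ^+ 2 + y ^+ 2) * ((1 - u) ^+ 2 + v ^+ 2) by ring.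
  by rewrite ler_piMl // addr_ge0 ?sqr_ge0.
rewrite -natr1; split.
- have -> : (s * u - y * v) ^+ 2 + (y * u + s * v) ^+ 2 =
    (s ^+ 2 + y ^+ 2) * (u ^+ 2 + v ^+ 2) by ring.
  by rewrite mulr_ile1 // addr_ge0 ?sqr_ge0.
- have h4 : (s * (1 - u) + y * v) ^+ 2 + (s * v - y * (1 - u)) ^+ 2 <=
      k%:R ^+ 2 * ((1 - s) ^+ 2 + y ^+ 2).
    apply: le_trans h2.
    have -> : (s * (1 - u) + y * v) ^+ 2 + (s * v - y * (1 - u)) ^+ 2 =
      (s ^+ 2 + y ^+ 2) * ((1 - u) ^+ 2 + v ^+ 2) by ring.
    by rewrite ler_piMl // addr_ge0 ?sqr_ge0.
  have -> : (1 - (s * u - y * v)) ^+ 2 + (y * u + s * v) ^+ 2 =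
    ((1 - s) ^+ 2 + y ^+ 2) +
    ((s * (1 - u) + y * v) ^+ 2 + (s * v - y * (1 - u)) ^+ 2) +
    2 * ((1 - s) * (s * (1 - u) + y * v) + y * (s * v - y * (1 - u))) by ring.
  move: h4 cross'; set X := _ + y ^+ 2; set Q := _ + _ ^+ 2; set C := _ + y * _.
  move=> h4 cross'.
  have : (k%:R + 1) ^+ 2 * X = X + k%:R ^+ 2 * X + 2 * (k%:R * X) by ring.
  lra.
have : 1 - (s * u - y * v) = (1 - u) + (1 - s) - ((1 - s) * (1 - u) - y * v) by ring.
have : (k%:R + 1) ^+ 2 * (1 - s) =
  k%:R ^+ 2 * (1 - s) + (1 - s) + k%:R * (2 * (1 - s)) by ring.
have : k%:R * ((1 - s) ^+ 2 + y ^+ 2) <= k%:R * (2 * (1 - s)) by apply: ler_wpM2l.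
lra.
Qed.

(** The Funk-Hecke formula at the basis vector e_i, where Re (X_i + sqrt(-1) X_j)^k equals 1, writes
    both differences as integrals against u^2 >= 0; the bounds of [complex_power_bounds] then
    integrate. *)
Lemma eigenval_bounds k (u : {poly R}) :
  0 <= eigenval n 0 (u ^+ 2) - eigenval n k (u ^+ 2) <=
  k%:R ^+ 2 * (eigenval n 0 (u ^+ 2) - eigenval n 0 ('X * u ^+ 2)).
Proof.
have n0 : (0 < n)%N by case: n i => [[]|].
have [I [w [pt cub]]] := cubature_exists R (size ('X * u ^+ 2)%R + size (u ^+ 2)%R + k) n0.
have [w0 _ wS _] := cub.
pose x (l : 'I_n) : R := (l == i)%:R.
have hx : sphere n x.
  rewrite /sphere /= (bigD1 i) //= /x eqxx expr1n big1 ?addr0 // => l /negPf ->.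
  by rewrite expr0n.
have dotx p : dotp x (pt p) = pt p i.
  rewrite /dotp (bigD1 i) //= /x eqxx mul1r big1 ?addr0 // => l /negPf ->.
  by rewrite mul0r.
have h1 := @harm_homog1 R n.
have FH0 (g : {poly R}) : (size g <= size ('X * u ^+ 2)%R + size (u ^+ 2)%R + k)%N ->
    eigenval n 0 g = \sum_p w p * g.[pt p i].
  move=> gs; have := @funk_hecke R n n0 _ _ _ _ cub g 0 1 x.
  rewrite addn0 meval1 mulr1 => <- //; last exact: leqW.
  by apply: eq_bigr => p _; rewrite meval1 mulr1 dotx.
have := complex_powerP k.
have := @complex_power_bounds k.
have : let: (a, b) := complex_power k in a.@[x] = 1 /\ b.@[x] = 0.
  have xi : x i = 1 by rewrite /x eqxx.
  have xj : x j = 0 by rewrite /x eq_sym (negPf neq_ij).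
  elim: (k) => [|l] /=; first by rewrite meval1 meval0.
  case: (complex_power l) => a b [ax bx].
  rewrite mevalB mevalD !mevalM !mevalXU ax bx xi xj.
  by split; ring.
case: (complex_power k) => a b [ax _] bnd [ha _ la _ _].
have FHk : eigenval n k (u ^+ 2) = \sum_p w p * ((u ^+ 2).[pt p i] * a.@[pt p]).
  have := @funk_hecke R n n0 _ _ _ _ cub (u ^+ 2) k a x.
  rewrite ax mulr1 => <- //; last by lia.
  by apply: eq_bigr => p _; rewrite dotx.
rewrite FHk !FH0; try lia.
rewrite -!sumrB mulr_sumr; apply/andP; split.
  apply: sumr_ge0 => p _; rewrite -mulrBr mulr_ge0 //.
  have [a1 _] := bnd _ (wS p).
  by rewrite horner_exp -{1}[_ ^+ 2]mulr1 -mulrBr mulr_ge0 ?sqr_ge0 // subr_ge0.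
apply: ler_sum => p _; have [_ a2] := bnd _ (wS p).
rewrite (hornerM 'X) hornerX horner_exp.
move: (u.[pt p i] ^+ 2) (sqr_ge0 (u.[pt p i])) => v v0.
have := w0 p; move: (w p) => W W0.
have -> : W * v - W * (v * a.@[pt p]) = W * v * (1 - a.@[pt p]) by ring.
have -> : k%:R ^+ 2 * (W * v - W * (pt p i * v)) =
  W * v * (k%:R ^+ 2 * (1 - pt p i)) by ring.
by apply: ler_wpM2l => //; rewrite mulr_ge0.
Qed.

End EigenvalueBounds.

(** * The harmonic constant *)

Section Gamma.
Local Open Scope classical_set_scope.
Variables (R : realType) (n : nat).
Hypothesis n_gt0 : (0 < n)%N.
Implicit Types x y : 'I_n -> R.

Lemma sphere_coord_le1 x i : sphere n x -> `|x i| <= 1.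
Proof.
move=> hx; rewrite -(expr_le1 (n := 2)) // real_normK ?num_real // -hx.
by rewrite (bigD1 i) //= lerDl sumr_ge0 // => j _; rewrite sqr_ge0.
Qed.

Lemma meval_bound m (p : {mpoly R[m]}) (v : 'I_m -> R) :
  (forall i, `|v i| <= 1) -> `|p.@[v]| <= \sum_(a <- msupp p) `|p@_a|.
Proof.
move=> hv; rewrite mevalE (le_trans (ler_norm_sum _ _ _)) // ler_sum // => a _.
rewrite normrM ler_piMr // normr_prod.
apply: prodr_ile1 => i _.
by rewrite normr_ge0 normrX exprn_ile1.
Qed.

Lemma dotp_le1 x y : sphere n x -> sphere n y -> `|dotp x y| <= 1.
Proof.
move=> hx hy; have h : \sum_(i < n) (x i ^+ 2 + y i ^+ 2) = 2.
  by rewrite big_split /= hx hy.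
rewrite ler_norml; apply/andP; split.
  have : 0 <= \sum_(i < n) (x i + y i) ^+ 2.
    by apply: sumr_ge0 => i _; rewrite sqr_ge0.
  have -> : \sum_(i < n) (x i + y i) ^+ 2 =
      \sum_(i < n) (x i ^+ 2 + y i ^+ 2) + 2 * dotp x y.
    by rewrite /dotp mulr_sumr -big_split; apply: eq_bigr => i _ /=; ring.
  by rewrite h; lra.
have : 0 <= \sum_(i < n) (x i - y i) ^+ 2.
  by apply: sumr_ge0 => i _; rewrite sqr_ge0.
have -> : \sum_(i < n) (x i - y i) ^+ 2 =
    \sum_(i < n) (x i ^+ 2 + y i ^+ 2) - 2 * dotp x y.
  by rewrite /dotp mulr_sumr -sumrB; apply: eq_bigr => i _ /=; ring.
by rewrite h; lra.
Qed.

Lemma horner_bound (g : {poly R}) (s : R) : `|s| <= 1 ->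
  `|g.[s]| <= \sum_(i < size g) `|g`_i|.
Proof.
move=> s1; rewrite horner_coef (le_trans (ler_norm_sum _ _ _)) // ler_sum // => i _.
by rewrite normrM ler_piMr // normrX exprn_ile1.
Qed.

(** Projection to H_k is convolution with the zonal kernel, hence bounded in sup norm. This bounds
    the set defining [gammaS], so that its [sup] is a genuine supremum. *)
Lemma harm_proj_bound d : exists2 B : R, 0 <= B &
  forall (p : {mpoly R[n]}) pk k M, harm_decomp d p pk -> (k <= d)%N ->
  (forall x, sphere n x -> `|p.@[x]| <= M) ->
  forall x, sphere n x -> `|(pk k).@[x]| <= B * M.
Proof.
have [I [w [pt cub]]] := cubature_exists R (d + d) n_gt0.
have [w0 w1 wS _] := cub.
pose b k : R := \sum_(i < size (zonal R n k)) `|(zonal R n k)`_i|.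
have b0 k : 0 <= b k by apply: sumr_ge0.
exists (\sum_(k < d.+1) b k) => [|p pk k M [hh hp] kd hM x hx].
  exact: sumr_ge0.
have E : (pk k).@[x] = \sum_i w i * ((zonal R n k).[dotp x (pt i)] * p.@[pt i]).
  have -> : \sum_i w i * ((zonal R n k).[dotp x (pt i)] * p.@[pt i]) =
      \sum_(l < d.+1) \sum_i w i * ((zonal R n k).[dotp x (pt i)] * (pk l).@[pt i]).
    rewrite exchange_big /=; apply: eq_bigr => i _.
    by rewrite -!mulr_sumr; congr (_ * (_ * _)); rewrite -hp.
  have F (l : 'I_d.+1) : \sum_i w i * ((zonal R n k).[dotp x (pt i)] * (pk l).@[pt i]) =
      (val l == k)%:R * (pk l).@[x].
    have ld : (l <= d)%N by rewrite -ltnS.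
    rewrite (funk_hecke n_gt0 cub (k := l)) ?eigenval_zonal //; last exact: hh.
    by have := size_zonal R n k; lia.
  rewrite (eq_bigr _ (fun l _ => F l)) (bigD1 (Ordinal (kd : k < d.+1)%N)) //=.
  rewrite eqxx mul1r big1 ?addr0 // => l; rewrite -val_eqE /= => /negPf ->.
  by rewrite mul0r.
have M0 : 0 <= M by apply: le_trans (hM _ hx).
rewrite E (le_trans (ler_norm_sum _ _ _)) //.
apply: (@le_trans _ _ (\sum_i w i * (b k * M))).
  apply: ler_sum => i _; rewrite normrM ger0_norm // ler_wpM2l // normrM.
  by rewrite ler_pM // ?hM // horner_bound // dotp_le1.
rewrite -mulr_suml w1 mul1r ler_wpM2r // (bigD1 (Ordinal (kd : k < d.+1)%N)) //=.
by rewrite lerDl sumr_ge0.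
Qed.

Lemma supnorm_has_sup (p : {mpoly R[n]}) x : sphere n x ->
  has_sup [set `|peval p x| | x in sphere n].
Proof.
move=> hx; split; first by exists `|peval p x|, x.
exists (\sum_(a <- msupp p) `|p@_a|) => _ [y hy <-].
by apply: meval_bound => i; exact: sphere_coord_le1.
Qed.

Lemma le_supnorm (p : {mpoly R[n]}) x : sphere n x -> `|p.@[x]| <= supnorm_S p.
Proof.
move=> hx; apply: sup_upper_bound; last by exists x.
exact: supnorm_has_sup hx.
Qed.

Lemma supnorm_le (p : {mpoly R[n]}) x M : sphere n x ->
  (forall x, sphere n x -> `|p.@[x]| <= M) -> supnorm_S p <= M.
Proof.
move=> hx hM; apply: ge_sup; first by exists `|peval p x|, x.
by move=> _ [y hy <-]; apply: hM.
Qed.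

(** The form in which the harmonic constant is used: any bound M replaces the norm of p, and p may
    vanish on the sphere. *)
Lemma gamma_bound d (p : {mpoly R[n]}) pk k M x :
  (pdeg p <= d)%N -> harm_decomp d p pk -> (k <= d)%N ->
  (forall y, sphere n y -> `|p.@[y]| <= M) -> sphere n x ->
  `|(pk k).@[x]| <= gammaS n d * M /\ 0 <= gammaS n d :> R.
Proof.
move=> pd hp kd hM hx.
have [B B0 hB] := harm_proj_bound d.
pose E : set R := [set r | exists (p : {mpoly R[n]}) pk k,
  [/\ (pdeg p <= d)%N, (exists2 x, sphere n x & peval p x != 0),
      harm_decomp d p pk, (k <= d)%N & r = supnorm_S (pk k) / supnorm_S p]].
have s0 (f : {mpoly R[n]}) : 0 <= supnorm_S f by apply: le_trans (le_supnorm f hx).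
have Eub : has_ubound E.
  exists B => _ [f [fk [l [_ [y hy fy] hf ld ->]]]].
  have f0 : 0 < supnorm_S f.
    by apply: lt_le_trans (le_supnorm f hy); rewrite normr_gt0.
  rewrite ler_pdivrMr //; apply: (supnorm_le hy) => z hz.
  by apply: hB hf ld _ _ hz => u hu; exact: le_supnorm.
have M0 : 0 <= M by apply: le_trans (hM _ hx).
have g0 : 0 <= gammaS n d :> R.
  have [E0|/set0P[r Er]] := eqVneq E set0.
    by rewrite /gammaS -/E E0 sup0 lexx.
  apply: le_trans (ub_le_sup Eub Er).
  by case: Er => f [fk [l [_ _ _ _ ->]]]; rewrite divr_ge0.
split => //.
have [[y hy py]|np] := pselect (exists2 y, sphere n y & p.@[y] != 0).
  have p0 : 0 < supnorm_S p.
    by apply: lt_le_trans (le_supnorm p hy); rewrite normr_gt0.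
  apply: le_trans (le_supnorm _ hx) _.
  apply: (@le_trans _ _ (gammaS n d * supnorm_S p)).
    rewrite -ler_pdivrMr //; apply: (ub_le_sup Eub).
    by exists p, pk, k; split => //; exists y.
  by rewrite ler_wpM2l //; exact: (supnorm_le hx hM).
(* Here p vanishes on the sphere and is excluded from the ratios in [gammaS]; the crude bound with M
   = 0 shows that its components vanish too. *)
apply: (@le_trans _ _ (B * 0)); last by rewrite mulr0 mulr_ge0.
apply: (hB _ _ _ _ hp) => // y hy; rewrite normr_le0.
by apply/negPn/negP => py; apply: np; exists y.
Qed.

End Gamma.

(** * The ideal of the product of spheres *)

Section DegreeBounds.
Variables (R : realType) (m : nat) (f : 'X_{1..m} -> nat).
Hypothesis f0 : f 0%MM = 0%N.
Hypothesis fD : forall a b, f (a + b)%MM = (f a + f b)%N.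
Implicit Types p q : {mpoly R[m]}.

(** The degree f is any additive one, to serve [mdeg], [degx] and [degy] alike. *)
Definition deg_le (D : nat) p : Prop := forall a, a \in msupp p -> (f a <= D)%N.

Lemma deg_leW D D' p : (D <= D')%N -> deg_le D p -> deg_le D' p.
Proof. by move=> DD hp a /hp /leq_trans; apply. Qed.

Lemma deg_le0 D : deg_le D 0.
Proof. by move=> a; rewrite msupp0. Qed.

Lemma deg_leC D c : deg_le D c%:MP.
Proof.
by move=> a; rewrite msuppC; case: eqP => // _; rewrite inE => /eqP ->; rewrite f0.
Qed.

Lemma deg_leD D p q : deg_le D p -> deg_le D q -> deg_le D (p + q).
Proof. by move=> hp hq a /msuppD_le; rewrite mem_cat => /orP[/hp|/hq]. Qed.

Lemma deg_leZ D c p : deg_le D p -> deg_le D (c *: p).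
Proof. by move=> hp a /msuppZ_le /hp. Qed.

Lemma deg_leB D p q : deg_le D p -> deg_le D q -> deg_le D (p - q).
Proof. by move=> hp hq; rewrite -scaleN1r; apply: deg_leD => //; apply: deg_leZ. Qed.

Lemma deg_leM D E p q : deg_le D p -> deg_le E q -> deg_le (D + E) (p * q).
Proof.
move=> hp hq a /msuppM_le /allpairsP[[b c] /= [/hp hb /hq hc ->]].
by rewrite fD leq_add.
Qed.

Lemma deg_leX D k p : deg_le D p -> deg_le (k * D) (p ^+ k).
Proof.
move=> hp; elim: k => [|k IH]; first by rewrite expr0 -mpolyC1; apply: deg_leC.
by rewrite exprS mulSn; apply: deg_leM.
Qed.

Lemma deg_le_sum D (I : Type) (r : seq I) (P : pred I) (F : I -> {mpoly R[m]}) :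
  (forall i, P i -> deg_le D (F i)) -> deg_le D (\sum_(i <- r | P i) F i).
Proof.
by move=> hF; elim/big_ind: _ => //; [exact: deg_le0 | exact: deg_leD].
Qed.

Lemma deg_le_monomial D a : (f a <= D)%N -> deg_le D 'X_[a].
Proof. by move=> h b; rewrite msuppX inE => /eqP ->. Qed.

End DegreeBounds.

Lemma pdeg_leP (R : realType) m D (p : {mpoly R[m]}) :
  (pdeg p <= D)%N <-> deg_le mdeg D p.
Proof.
rewrite /pdeg; split=> [h a /msize_mdeg_lt ap|h].
  by rewrite -ltnS (leq_trans ap) // (leq_trans (leqSpred _)).
suff : (msize p <= D.+1)%N by case: (msize p).
by rewrite msizeE; apply/bigmax_leqP_seq => a /h.
Qed.

Lemma positional_inj K n (a b : 'I_n -> nat) :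
  (forall i, (a i < K)%N) -> (forall i, (b i < K)%N) ->
  (\sum_(i < n) a i * K ^ i = \sum_(i < n) b i * K ^ i)%N -> a =1 b.
Proof.
elim: n a b => [|n IH] a b aK bK; first by move=> _ [].
have K0 : (0 < K)%N by apply: leq_ltn_trans (aK ord0).
rewrite !big_ord_recl !expn0 !muln1.
have E (c : 'I_n.+1 -> nat) : (\sum_(i < n) c (lift ord0 i) * K ^ (lift ord0 i) =
    (\sum_(i < n) c (lift ord0 i) * K ^ i) * K)%N.
  by rewrite big_distrl; apply: eq_bigr => i _; rewrite lift0 expnSr mulnA.
rewrite !E => h.
have h0 : a ord0 = b ord0.
  by move/(congr1 (modn^~ K)): h; rewrite ![(_ + _ * K)%N]addnC !modnMDl !modn_small.
move: h; rewrite h0 => /addnI /eqP; rewrite eqn_pmul2r // => /eqP h.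
have {}IH := IH _ _ (fun i => aK _) (fun i => bK _) h.
by move=> i; case: (unliftP ord0 i) => [j ->|-> //]; exact: IH.
Qed.

Lemma poly_fun_eq0 (R : numDomainType) (g : {poly R}) :
  (forall s, g.[s] = 0) -> g = 0.
Proof.
move=> h; apply: (@roots_geq_poly_eq0 _ g [seq i%:R | i <- iota 0 (size g)]).
- by apply/allP => s _; apply/eqP/h.
- rewrite map_inj_uniq ?iota_uniq // => a b /eqP.
  by rewrite eqr_nat => /eqP.
- by rewrite size_map size_iota.
Qed.

(* Kronecker substitution X_i := s^(K^i) with K larger than the degree. *)
Lemma mpoly_fun_eq0 (R : numDomainType) n (p : {mpoly R[n]}) :
  (forall v, p.@[v] = 0) -> p = 0.
Proof.
move=> hp; pose K := (msize p).+1.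
pose pos (a : 'X_{1..n}) := (\sum_(i < n) a i * K ^ i)%N.
have posK (a b : 'X_{1..n}) : a \in msupp p -> b \in msupp p -> pos a = pos b -> a = b.
  move=> ap bp e; apply/mnmP; apply: (@positional_inj K) => // i.
    rewrite /K ltnS ltnW //; apply: leq_ltn_trans (msize_mdeg_lt ap).
    by rewrite mdegE (bigD1 i) //= leq_addr.
  rewrite /K ltnS ltnW //; apply: leq_ltn_trans (msize_mdeg_lt bp).
  by rewrite mdegE (bigD1 i) //= leq_addr.
have g0 : \sum_(a <- msupp p) p@_a *: 'X^(pos a) = 0 :> {poly R}.
  apply: poly_fun_eq0 => s; rewrite horner_sum -[RHS](hp (fun i => s ^+ (K ^ i))) mevalE.
  apply: eq_bigr => a _; rewrite hornerZ hornerXn /pos -prodrXr; congr (_ * _).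
  by apply: eq_bigr => i _; rewrite -exprM mulnC.
apply/mpolyP => a; rewrite mcoeff0.
have [ap|/memN_msupp_eq0 //] := boolP (a \in msupp p).
move/(congr1 (fun g : {poly R} => g`_(pos a))): g0.
rewrite coef0 coef_sum (bigD1_seq a) ?msupp_uniq //= coefZ coefXn eqxx mulr1.
rewrite big_seq_cond big1 ?addr0 // => b /andP[bp ba].
rewrite coefZ coefXn; case: eqP => [/(posK _ _ ap bp) e|_]; last by rewrite mulr0.
by rewrite e eqxx in ba.
Qed.

(** * Bidegrees and certificates on the product of spheres *)

Section Certificate.
Variables (R : realType) (n : nat).
Hypothesis n_gt0 : (0 < n)%N.
Local Notation Poly2 := {mpoly R[n + n]}.
Implicit Types (p : {mpoly R[n + n]}) (v : 'I_(n + n) -> R) (a : 'X_{1..n + n}).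

Definition degx a : nat := (\sum_(i < n) a (lshift n i))%N.
Definition degy a : nat := (\sum_(i < n) a (rshift n i))%N.

Lemma degx0 : degx 0%MM = 0%N.
Proof. by rewrite /degx big1 // => i _; rewrite mnm0E. Qed.
Lemma degy0 : degy 0%MM = 0%N.
Proof. by rewrite /degy big1 // => i _; rewrite mnm0E. Qed.
Lemma degxD a b : degx (a + b)%MM = (degx a + degx b)%N.
Proof. by rewrite /degx -big_split; apply: eq_bigr => i _; rewrite mnmDE. Qed.
Lemma degyD a b : degy (a + b)%MM = (degy a + degy b)%N.
Proof. by rewrite /degy -big_split; apply: eq_bigr => i _; rewrite mnmDE. Qed.
Lemma mdeg_xy a : mdeg a = (degx a + degy a)%N.
Proof. by rewrite mdegE big_split_ord. Qed.

Definition sqx : Poly2 := \sum_(i < n) 'X_(lshift n i) ^+ 2.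
Definition sqy : Poly2 := \sum_(i < n) 'X_(rshift n i) ^+ 2.

Lemma gxE : gx n = 1 - sqx :> Poly2.
Proof. by rewrite /gx /pconst mpolyC1. Qed.
Lemma gyE : gy n = 1 - sqy :> Poly2.
Proof. by rewrite /gy /pconst mpolyC1. Qed.

Definition point x y : 'I_(n + n) -> R :=
  fun i => match split i with inl j => x j | inr j => y j end.

Lemma pointL x y i : point x y (lshift n i) = x i.
Proof. by rewrite /point (unsplitK (inl _ i)). Qed.
Lemma pointR x y i : point x y (rshift n i) = y i.
Proof. by rewrite /point (unsplitK (inr _ i)). Qed.

Lemma Xset_point x y : sphere n x -> sphere n y -> Xset n (point x y).
Proof.
move=> hx hy; split.
  by rewrite /sphere /= -[RHS]hx; apply: eq_bigr => i _; rewrite pointL.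
by rewrite /sphere /= -[RHS]hy; apply: eq_bigr => i _; rewrite pointR.
Qed.

Lemma eval_sqx v : sqx.@[v] = \sum_(i < n) v (lshift n i) ^+ 2.
Proof. by rewrite meval_sum; apply: eq_bigr => i _; rewrite rmorphXn /= mevalXU. Qed.
Lemma eval_sqy v : sqy.@[v] = \sum_(i < n) v (rshift n i) ^+ 2.
Proof. by rewrite meval_sum; apply: eq_bigr => i _; rewrite rmorphXn /= mevalXU. Qed.

Lemma sqx_deg : deg_le mdeg 2 sqx.
Proof.
apply: deg_le_sum => i _; rewrite mpolyXn.
by apply: deg_le_monomial; rewrite mdegMn mdeg1.
Qed.
Lemma sqy_deg : deg_le mdeg 2 sqy.
Proof.
apply: deg_le_sum => i _; rewrite mpolyXn.
by apply: deg_le_monomial; rewrite mdegMn mdeg1.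
Qed.

Lemma eval_scaled_point a x y b c :
  'X_[R, a].@[point (fun i => b * x i) (fun i => c * y i)] =
  b ^+ degx a * c ^+ degy a * 'X_[a].@[point x y].
Proof.
rewrite !mevalX !big_split_ord /= mulrACA /degx /degy.
congr (_ * _); rewrite -prodrXr -big_split; apply: eq_bigr => i _.
  by rewrite !pointL exprMn.
by rewrite !pointR exprMn.
Qed.

(* The halves round down: each parity class of p is homogenised to its own bidegree. *)
Lemma bihomogenization_eq0 t p : (0 < t)%N ->
  deg_le degx t.*2 p -> deg_le degy t.*2 p ->
  (forall v, Xset n v -> p.@[v] = 0) ->
  \sum_(a <- msupp p) p@_a *:
    ('X_[a] * sqx ^+ (t.*2 - degx a)./2 * sqy ^+ (t.*2 - degy a)./2) = 0.
Proof.
move=> t0 px py p0; set N := \sum_(a <- _) _.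
(* The extra factors, nonzero polynomials, dispose of the points where a block of v is zero and
   cannot be normalised. *)
suff : N * (sqx * sqy) = 0.
  have sq0 (s : Poly2) v : s.@[v] != 0 -> s != 0.
    by apply: contraNneq => ->; rewrite meval0.
  have one : \sum_(i < n) (1 : R) ^+ 2 != 0.
    under eq_bigr do rewrite expr1n.
    by rewrite sumr_const card_ord pnatr_eq0 -lt0n.
  move/eqP; rewrite !mulf_eq0 => /orP[/eqP //|].
  rewrite (negPf (sq0 sqx (fun=> 1) _)) ?eval_sqx //.
  by rewrite (negPf (sq0 sqy (fun=> 1) _)) ?eval_sqy.
apply: mpoly_fun_eq0 => v; rewrite !mevalM.
pose x i := v (lshift n i); pose y i := v (rshift n i).
pose r := Num.sqrt sqx.@[v]; pose s := Num.sqrt sqy.@[v].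
have [X0|X0] := eqVneq sqx.@[v] 0; first by rewrite X0 mul0r mulr0.
have [Y0|Y0] := eqVneq sqy.@[v] 0; first by rewrite Y0 !mulr0.
suff -> : N.@[v] = 0 by rewrite mul0r.
have r2 : r ^+ 2 = sqx.@[v].
  by rewrite sqr_sqrtr // eval_sqx sumr_ge0 // => i _; rewrite sqr_ge0.
have s2 : s ^+ 2 = sqy.@[v].
  by rewrite sqr_sqrtr // eval_sqy sumr_ge0 // => i _; rewrite sqr_ge0.
have r0 : r != 0 by rewrite -(sqrf_eq0 r) r2.
have s0 : s != 0 by rewrite -(sqrf_eq0 s) s2.
pose x' i := r^-1 * x i; pose y' i := s^-1 * y i.
have hx' : sphere n x'.
  rewrite /sphere /= /x'; under eq_bigr do rewrite exprMn.
  by rewrite -mulr_sumr -eval_sqx exprVn r2 mulVf.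
have hy' : sphere n y'.
  rewrite /sphere /= /y'; under eq_bigr do rewrite exprMn.
  by rewrite -mulr_sumr -eval_sqy exprVn s2 mulVf.
have sgn (z : 'I_n -> R) b : sphere n z -> sphere n (fun i => (-1) ^+ (b : bool) * z i).
  by move=> hz; rewrite /sphere /= -[RHS]hz; apply: eq_bigr => i _; rewrite exprMn sqrr_sign mul1r.
pose c (r : R) (b : bool) := (r ^+ t.*2 + (-1) ^+ b * r ^+ t.*2.-1) / 2.
(* r ^ (d + 2 floor((2t - d) / 2)) only depends on the parity of d. *)
have par (z : R) d : (d <= t.*2)%N ->
    z ^+ d * (z ^+ 2) ^+ (t.*2 - d)./2 =
    \sum_(b : bool) c z b * ((-1) ^+ b) ^+ d.
  move=> dt; rewrite big_bool -exprM -exprD /c /= !expr0 !expr1 expr1n -(signr_odd _ d).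
  case: (boolP (odd d)) => od.
    have -> : (d + 2 * (t.*2 - d)./2 = t.*2.-1)%N by lia.
    by rewrite expr1; field.
  have -> : (d + 2 * (t.*2 - d)./2 = t.*2)%N by lia.
  by rewrite expr0; field.
(* N(v) is a combination of the values of p at the four points (+-x', +-y') of X. *)
have -> : N.@[v] = \sum_(b1 : bool) \sum_(b2 : bool) c r b1 * c s b2 *
    p.@[point (fun i => (-1) ^+ b1 * x' i) (fun i => (-1) ^+ b2 * y' i)].
  have pE w : p.@[w] = \sum_(a <- msupp p) p@_a * 'X_[a].@[w].
    by rewrite {1}(mpolyE p) meval_sum; apply: eq_bigr => a _; rewrite mevalZ.
  under [RHS]eq_bigr => b1 _ do under eq_bigr => b2 _ do rewrite pE mulr_sumr.
  under [RHS]eq_bigr => b1 _ do rewrite exchange_big /=.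
  rewrite exchange_big /= /N meval_sum big_seq [RHS]big_seq.
  apply: eq_bigr => a ap.
  have -> : \sum_(b1 : bool) \sum_(b2 : bool) c r b1 * c s b2 * (p@_a *
     'X_[a].@[point (fun i => (-1) ^+ b1 * x' i) (fun i => (-1) ^+ b2 * y' i)]) =
    p@_a * 'X_[a].@[point x' y'] * ((\sum_(b1 : bool) c r b1 * ((-1) ^+ b1) ^+ degx a) *
      (\sum_(b2 : bool) c s b2 * ((-1) ^+ b2) ^+ degy a)).
    under eq_bigr => b1 _ do under eq_bigr => b2 _ do rewrite eval_scaled_point.
    move: ('X_[a].@[point x' y']) => z3.
    rewrite mulr_suml mulr_sumr; apply: eq_bigr => b1 _.
    rewrite !mulr_sumr; apply: eq_bigr => b2 _.
    by move: (_ ^+ degx a) (_ ^+ degy a) => z1 z2; ring.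
  rewrite -(par r _ (px a ap)) -(par s _ (py a ap)) mevalZ !mevalM !rmorphXn /= r2 s2.
  have -> : 'X_[a].@[v] = r ^+ degx a * s ^+ degy a * 'X_[a].@[point x' y'].
    rewrite -eval_scaled_point; apply: meval_eq => i.
    case: (split_ordP i) => j ->; rewrite ?pointL ?pointR.
      by rewrite /x' mulrA mulfV // mul1r.
    by rewrite /y' mulrA mulfV // mul1r.
  move: (r ^+ degx a) (s ^+ degy a) ('X_[a].@[_]) => z1 z2 z3.
  by move: (_ ^+ (_ - degx a)./2) (_ ^+ (_ - degy a)./2) => z4 z5; ring.
rewrite big1 // => b1 _; rewrite big1 // => b2 _.
by rewrite p0 ?mulr0 //; apply: Xset_point; apply: sgn.
Qed.

(** Subtract from p its bihomogenization, which is 0. With A = |x|^2 and B = |y|^2, each monomial is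
    multiplied by 1 - A^e B^f = (1 - A^e) + A^e (1 - B^f), and geometric sums split off the
    generators. *)
Lemma vanishing_certificate t p : (0 < t)%N ->
  deg_le degx t.*2 p -> deg_le degy t.*2 p ->
  (forall v, Xset n v -> p.@[v] = 0) ->
  exists h1 h2 : Poly2, [/\ deg_le mdeg (4 * t - 2) h1,
    deg_le mdeg (4 * t - 2) h2 & p = h1 * gx n + h2 * gy n].
Proof.
move=> t0 px py p0.
have N0 := bihomogenization_eq0 t0 px py p0.
pose ex a := (t.*2 - degx a)./2; pose ey a := (t.*2 - degy a)./2.
exists (\sum_(a <- msupp p) p@_a *: ('X_[a] * \sum_(i < ex a) sqx ^+ i)).
exists (\sum_(a <- msupp p)
  p@_a *: ('X_[a] * sqx ^+ ex a * \sum_(i < ey a) sqy ^+ i)).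
have geom (s : Poly2) k : (\sum_(i < k) s ^+ i) * (1 - s) = 1 - s ^+ k.
  by rewrite -[1 - s]opprB -[1 - s ^+ k]opprB subrX1 mulrN mulrC.
split.
- rewrite big_seq; apply: deg_le_sum => a ap; apply: deg_leZ.
  rewrite mulr_sumr; apply: deg_le_sum => i _.
  apply: (@deg_leW _ _ _ (mdeg a + i * 2)).
    by have := px a ap; have := py a ap; have := ltn_ord i; rewrite mdeg_xy /ex; lia.
  apply: deg_leM; first exact: mdegD; first exact: deg_le_monomial.
  by apply: deg_leX sqx_deg; [exact: mdeg0 | exact: mdegD].
- rewrite big_seq; apply: deg_le_sum => a ap; apply: deg_leZ.
  rewrite mulr_sumr; apply: deg_le_sum => i _.
  apply: (@deg_leW _ _ _ (mdeg a + ex a * 2 + i * 2)).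
    by have := px a ap; have := py a ap; have := ltn_ord i; rewrite mdeg_xy /ex /ey; lia.
  apply: deg_leM; first exact: mdegD; last first.
    by apply: deg_leX sqy_deg; [exact: mdeg0 | exact: mdegD].
  apply: deg_leM; first exact: mdegD; first exact: deg_le_monomial.
  by apply: deg_leX sqx_deg; [exact: mdeg0 | exact: mdegD].
rewrite gxE gyE -[LHS]subr0 -[X in _ - X = _]N0 {1}[p]mpolyE -sumrB.
rewrite [X in _ = X + _]mulr_suml [X in _ = _ + X]mulr_suml -big_split.
apply: eq_bigr => a _ /=; rewrite -!scalerAl -scalerBr -scalerDr; congr (_ *: _).
by rewrite -!mulrA !geom /=; ring.
Qed.

(** Equality on X suffices, since the difference lies in the ideal with controlled degrees. Squares
    of polynomials of bidegree (t, t) have total degree up to 4t, whence the level 2t. *)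
Lemma in_TX_certificate (I : finType) (W : I -> R) (F : I -> Poly2) t p :
  (0 < t)%N -> (forall i, 0 <= W i) ->
  (forall i, deg_le degx t (F i)) -> (forall i, deg_le degy t (F i)) ->
  deg_le degx t.*2 p -> deg_le degy t.*2 p ->
  (forall v, Xset n v -> p.@[v] = \sum_i W i * (F i).@[v] ^+ 2) ->
  in_TX n (2 * t) p.
Proof.
move=> t0 W0 Fx Fy px py pE.
pose sigma : Poly2 := \sum_i W i *: F i ^+ 2.
have sx : deg_le degx t.*2 sigma.
  apply: deg_le_sum => i _; apply: deg_leZ; rewrite -mul2n.
  by apply: deg_leX (Fx i); [exact: degx0 | exact: degxD].
have sy : deg_le degy t.*2 sigma.
  apply: deg_le_sum => i _; apply: deg_leZ; rewrite -mul2n.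
  by apply: deg_leX (Fy i); [exact: degy0 | exact: degyD].
have v0 v : Xset n v -> (p - sigma).@[v] = 0.
  move=> hv; rewrite mevalB pE // meval_sum; apply/eqP; rewrite subr_eq0; apply/eqP.
  by apply: eq_bigr => i _; rewrite mevalZ rmorphXn.
have [h1 [h2 [d1 d2 e]]] :=
  vanishing_certificate t0 (deg_leB px sx) (deg_leB py sy) v0.
exists sigma, h1, h2; split.
- exists [seq Num.sqrt (W i) *: F i | i <- enum I].
  rewrite big_map big_enum; apply: eq_bigr => i _.
  by rewrite exprZn sqr_sqrtr.
- apply/pdeg_leP => a as_; rewrite mdeg_xy.
  by have := sx a as_; have := sy a as_; lia.
- by apply/pdeg_leP; apply: deg_leW d1; lia.
- by apply/pdeg_leP; apply: deg_leW d2; lia.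
by rewrite -addrA -e addrC subrK.
Qed.

End Certificate.

(** * The lower bound *)

(** With L = (1 - a) (1 - b), L >= 1 - B/2 >= 7/8, so 1/L - 1 <= (B/2)/L <= 8 B. *)
Lemma inv_ratio_bound (R : realFieldType) (a b B : R) :
  0 <= a -> 0 <= b -> a + b <= B / 2 -> B <= 1 / 4 ->
  `|((1 - a) * (1 - b))^-1 - 1| <= 8 * B.
Proof.
move=> a0 b0 ab B4; set L := (1 - a) * (1 - b).
have L1 : 1 - B / 2 <= L by rewrite /L; nra.
have L2 : L <= 1 by rewrite /L; nra.
have L0 : 0 < L by lra.
rewrite ger0_norm; last by rewrite subr_ge0 invf_ge1.
have -> : L^-1 - 1 = (1 - L) / L by field; exact: lt0r_neq0.
rewrite ler_pdivrMr //; nra.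
Qed.

(** * Choice of the kernel under the hypothesis on t *)

Section Assembly.
Variables (R : realType) (n d t : nat).
Hypothesis n_gt0 : (0 < n)%N.
Hypothesis d_gt0 : (0 < d)%N.
Hypothesis t_ge : (2 * n * d)%:R * Num.sqrt d%:R <= t%:R :> R.

Lemma level_ge : (d <= t)%N.
Proof.
rewrite -(ler_nat R); apply: le_trans t_ge.
apply: (@le_trans _ _ (d%:R * 1)); first by rewrite mulr1.
apply: ler_pM => //; first by rewrite ler_nat; nia.
by rewrite -[X in X <= _]sqrtr1; apply: ler_wsqrtr; rewrite ler1n.
Qed.

Lemma level_gt0 : (0 < t)%N. Proof. exact: leq_trans level_ge. Qed.

(** The hypothesis on t, squared; it makes n^2 d^3 / t^2 at most 1/4. *)
Lemma level_sqr : 4 * n%:R ^+ 2 * d%:R ^+ 3 <= t%:R ^+ 2 :> R.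
Proof.
have -> : 4 * n%:R ^+ 2 * d%:R ^+ 3 = ((2 * n * d)%:R * Num.sqrt d%:R) ^+ 2 :> R.
  by rewrite exprMn sqr_sqrtr ?ler0n // !natrM; ring.
by rewrite lerXn2r // nnegrE ?mulr_ge0 ?ler0n ?sqrtr_ge0.
Qed.

(** Let a_k be 1 minus the normalised eigenvalue. Then a_k <= k^2 eta with eta <= n^2 / (2 t^2), so
    a_k + a_l <= (k + l)^2 eta <= d^2 eta <= B / 2 for B = n^2 d^3 / t^2 <= 1/4. *)
Lemma kernel_ratio (i j : 'I_n) : i != j -> exists u : {poly R},
  [/\ (size u <= t.+1)%N, 0 < eigenval n 0 (u ^+ 2) &
   forall k l, (k + l <= d)%N -> 0 < eigenval n k (u ^+ 2) /\
    `|eigenval n 0 (u ^+ 2) ^+ 2 / (eigenval n k (u ^+ 2) * eigenval n l (u ^+ 2)) - 1|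
     <= 8 * n%:R ^+ 2 * d%:R ^+ 3 / t%:R ^+ 2].
Proof.
move=> ij; have [u [su E0 gap]] := kernel_gap R n_gt0 t.
exists u; split => // k l kl.
have bnd := eigenval_bounds ij _ u.
set E := fun k => eigenval n k (u ^+ 2).
rewrite -/(E 0%N) -/(E k) -/(E l).
rewrite -/(E 0%N) in E0 gap.
set e1 := eigenval n 0 ('X * u ^+ 2) in gap.
pose eta := (E 0%N - e1) / E 0%N.
pose a k := (E 0%N - E k) / E 0%N.
have E0n : E 0%N != 0 by exact: lt0r_neq0.
have aE m : E m = E 0%N * (1 - a m) by rewrite /a; field.
have ha m : 0 <= a m <= m%:R ^+ 2 * eta.
  have /andP[h1 h2] := bnd m; rewrite /a /eta mulrA.
  by rewrite divr_ge0 ?(ltW E0) //= ler_pM2r ?invr_gt0.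
have t0 : 0 < t%:R :> R by rewrite ltr0n level_gt0.
have T0 : 0 < t%:R ^+ 2 :> R by rewrite exprn_gt0.
have heta : 2 * t%:R ^+ 2 * eta <= n%:R ^+ 2.
  by rewrite /eta mulrA ler_pdivrMr.
pose B : R := n%:R ^+ 2 * d%:R ^+ 3 / t%:R ^+ 2.
have B4 : B <= 1 / 4.
  by rewrite /B ler_pdivrMr //; have := level_sqr; lra.
have eta0 : 0 <= eta by have /andP[] := ha 1%N; rewrite expr1n mul1r; exact: le_trans.
have Bd : d%:R ^+ 2 * eta <= B / 2.
  have -> : B / 2 = n%:R ^+ 2 * d%:R ^+ 3 / (2 * t%:R ^+ 2).
    by rewrite /B; field; rewrite pnatr_eq0 -lt0n level_gt0.
  rewrite ler_pdivlMr ?mulr_gt0 //.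
  apply: (@le_trans _ _ (d%:R ^+ 2 * n%:R ^+ 2)).
    by rewrite -mulrA ler_wpM2l ?exprn_ge0 ?ler0n // mulrC.
  rewrite mulrC ler_wpM2l ?exprn_ge0 ?ler0n // [X in _ <= X]exprSr.
  by rewrite ler_peMr ?exprn_ge0 ?ler0n // ler1n.
have sum_le m p : (m + p <= d)%N -> a m + a p <= B / 2.
  move=> mp; have /andP[_ h1] := ha m; have /andP[_ h2] := ha p.
  apply: le_trans Bd; apply: le_trans (lerD h1 h2) _.
  rewrite -mulrDl ler_wpM2r // -!natrX -natrD ler_nat.
  apply: (@leq_trans ((m + p) ^ 2)); last by rewrite leq_sqr.
  by rewrite sqrnD leq_addr.
have h1 m : (m <= d)%N -> 0 < E m.
  move=> md; rewrite aE mulr_gt0 // subr_gt0.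
  have := sum_le m 0%N; rewrite addn0 => /(_ md).
  by have /andP[] := ha 0%N; lra.
have kd := leq_trans (leq_addr l k) kl.
have ld := leq_trans (leq_addl k l) kl.
split; first exact: h1.
have -> : 8 * n%:R ^+ 2 * d%:R ^+ 3 / t%:R ^+ 2 = 8 * B by rewrite /B; ring.
have -> : E 0%N ^+ 2 / (E k * E l) = ((1 - a k) * (1 - a l))^-1.
  have n1 m : (m <= d)%N -> 1 - a m != 0.
    by move=> /h1; rewrite aE pmulr_rgt0 // => /lt0r_neq0.
  have nk := n1 k kd.
  have nl := n1 l ld.
  rewrite (aE k) (aE l); move: (1 - a k) (1 - a l) nk nl => x y x0 y0.
  by field; rewrite E0n x0 y0.
have /andP[a0 _] := ha k; have /andP[b0 _] := ha l.
exact: inv_ratio_bound (sum_le _ _ kl) B4.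
Qed.

End Assembly.

(** * Components harmonic in each block of variables *)

Section Biharmonic.
Variables (R : realType) (n : nat).
Hypothesis n_gt0 : (0 < n)%N.
Implicit Types (f q : {mpoly R[n + n]}) (x y : 'I_n -> R) (a : 'X_{1..n + n}).

Definition mnmx a : 'X_{1..n} := [multinom a (lshift n i) | i < n].
Definition mnmy a : 'X_{1..n} := [multinom a (rshift n i) | i < n].

Lemma mdeg_mnmx a : mdeg (mnmx a) = degx a.
Proof. by rewrite mdegE; apply: eq_bigr => i _; rewrite mnmE. Qed.

Lemma mdeg_mnmy a : mdeg (mnmy a) = degy a.
Proof. by rewrite mdegE; apply: eq_bigr => i _; rewrite mnmE. Qed.

Lemma eval_monomial_point a x y :
  'X_[R, a].@[point x y] = 'X_[mnmx a].@[x] * 'X_[mnmy a].@[y].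
Proof.
rewrite !mevalX big_split_ord /=; congr (_ * _); apply: eq_bigr => i _.
  by rewrite pointL mnmE.
by rewrite pointR mnmE.
Qed.

Lemma eval_point f x y : f.@[point x y] =
  \sum_(a <- msupp f) f@_a * ('X_[mnmx a].@[x] * 'X_[mnmy a].@[y]).
Proof.
rewrite {1}(mpolyE f) meval_sum; apply: eq_bigr => a _.
by rewrite mevalZ eval_monomial_point.
Qed.

Lemma meval_point f v :
  f.@[v] = f.@[point (fun i => v (lshift n i)) (fun i => v (rshift n i))].
Proof.
by apply: meval_eq => i; case: (split_ordP i) => j ->; rewrite ?pointL ?pointR.
Qed.

(** The component of f in H_k (x) H_l, for decompositions [h] of the monomials fixed in advance. *)
Definition bicomponent (h : 'X_{1..n} -> nat -> {mpoly R[n]}) f k l x y : R :=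
  \sum_(a <- msupp f) f@_a * ((h (mnmx a) k).@[x] * (h (mnmy a) l).@[y]).

Definition monomial_decomp (h : 'X_{1..n} -> nat -> {mpoly R[n]}) : Prop :=
  forall m, [/\ forall k, harm_homog k (h m k),
    forall k, (mdeg m < k)%N -> h m k = 0 &
    forall d x, (mdeg m <= d)%N -> sphere n x ->
      'X_[m].@[x] = \sum_(k < d.+1) (h m k).@[x]].

Section Components.
Variables (h : 'X_{1..n} -> nat -> {mpoly R[n]}) (d : nat) (f : {mpoly R[n + n]}).
Hypothesis hP : monomial_decomp h.
Hypothesis fd : (pdeg f <= d)%N.

Let deg_xy a : a \in msupp f -> (degx a + degy a <= d)%N.
Proof. by move=> af; rewrite -mdeg_xy; move/pdeg_leP: fd; apply. Qed.

Lemma bicomponent_gt k l x y : (d < k + l)%N -> bicomponent h f k l x y = 0.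
Proof.
move=> kl; rewrite /bicomponent big_seq big1 // => a /deg_xy axy.
have [_ hx _] := hP (mnmx a); have [_ hy _] := hP (mnmy a).
have [xk|kx] := ltnP (degx a) k.
  by rewrite hx ?mdeg_mnmx // meval0 mul0r mulr0.
by rewrite hy ?mdeg_mnmy ?meval0 ?mulr0 //; lia.
Qed.

Lemma sum_bicomponent x y : sphere n x -> sphere n y ->
  f.@[point x y] = \sum_(k < d.+1) \sum_(l < d.+1) bicomponent h f k l x y.
Proof.
move=> Sx Sy; rewrite eval_point /bicomponent.
under [RHS]eq_bigr => k _ do rewrite exchange_big /=.
rewrite exchange_big /= big_seq [RHS]big_seq; apply: eq_bigr => a /deg_xy axy.
have [_ _ hx] := hP (mnmx a); have [_ _ hy] := hP (mnmy a).
rewrite (hx d) ?mdeg_mnmx //; last by lia.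
rewrite (hy d) ?mdeg_mnmy //; last by lia.
rewrite mulr_suml mulr_sumr; apply: eq_bigr => k _.
by rewrite !mulr_sumr.
Qed.

(* Apply the definition of gamma first to f(., y), then to its components in x as functions of y. *)
Lemma bicomponent_bound M k l x y :
  (forall x y, sphere n x -> sphere n y -> `|f.@[point x y]| <= M) ->
  (k <= d)%N -> (l <= d)%N -> sphere n x -> sphere n y ->
  `|bicomponent h f k l x y| <= gammaS n d ^+ 2 * M.
Proof.
move=> hM kd ld Sx Sy.
(* [c] holds one block, evaluated or already projected; [comb] is the resulting polynomial in the
   other block and [combh] gives its components. *)
pose comb (m : 'X_{1..n + n} -> 'X_{1..n}) (c : 'X_{1..n + n} -> R) : {mpoly R[n]} :=
  \sum_(a <- msupp f) (f@_a * c a) *: 'X_[m a].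
pose combh (m : 'X_{1..n + n} -> 'X_{1..n}) (c : 'X_{1..n + n} -> R) k : {mpoly R[n]} :=
  \sum_(a <- msupp f) (f@_a * c a) *: h (m a) k.
have comb_deg m c : (forall a, a \in msupp f -> mdeg (m a) <= d)%N ->
    (pdeg (comb m c) <= d)%N.
  move=> md; apply/pdeg_leP; rewrite /comb big_seq; apply: deg_le_sum => a /md ad.
  by apply: deg_leZ; exact: deg_le_monomial.
have comb_harm m c : (forall a, a \in msupp f -> mdeg (m a) <= d)%N ->
    harm_decomp d (comb m c) (combh m c).
  move=> md; split=> [l' _|z Sz].
    apply: harm_homog_sum => a; apply: harm_homogZ.
    by have [hh _ _] := hP (m a); exact: hh.
  rewrite /peval /comb meval_sum.
  under [RHS]eq_bigr do rewrite meval_sum.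
  rewrite exchange_big /= big_seq [RHS]big_seq; apply: eq_bigr => a /md ad.
  have [_ _ hd] := hP (m a); rewrite mevalZ (hd d) // mulr_sumr.
  by apply: eq_bigr => k' _; rewrite mevalZ.
have mx a : a \in msupp f -> (mdeg (mnmx a) <= d)%N.
  by move=> /deg_xy; rewrite mdeg_mnmx; lia.
have my a : a \in msupp f -> (mdeg (mnmy a) <= d)%N.
  by move=> /deg_xy; rewrite mdeg_mnmy; lia.
have step z : sphere n z ->
    `|(combh mnmx (fun a => 'X_[mnmy a].@[z]) k).@[x]| <= gammaS n d * M.
  move=> Sz; apply: (gamma_bound n_gt0 _ (comb_harm _ _ mx) kd _ Sx).1.
    exact: comb_deg.
  move=> z' Sz'; have := hM z' z Sz' Sz; rewrite eval_point /comb meval_sum.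
  congr (`|_| <= _); apply: eq_bigr => a _.
  by rewrite mevalZ mulrA mulrAC.
have -> : bicomponent h f k l x y =
    (combh mnmy (fun a => (h (mnmx a) k).@[x]) l).@[y].
  rewrite /bicomponent /combh meval_sum; apply: eq_bigr => a _.
  by rewrite mevalZ mulrA.
rewrite expr2 -mulrA.
apply: (gamma_bound n_gt0 _ (comb_harm _ _ my) ld _ Sy).1.
  exact: comb_deg.
move=> z Sz; have := step z Sz; rewrite /combh /comb !meval_sum.
congr (`|_| <= _); apply: eq_bigr => a _.
by rewrite !mevalZ mulrAC.
Qed.

End Components.

Lemma bicomponent_kernel h f D (I : finType) (w : I -> R) (pt : I -> 'I_n -> R)
    (g : {poly R}) k l x y :
  monomial_decomp h -> cubature D w pt ->
  (size g + k <= D.+1)%N -> (size g + l <= D.+1)%N -> sphere n x -> sphere n y ->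
  \sum_i \sum_j w i * w j * (g.[dotp x (pt i)] * g.[dotp y (pt j)]) *
    bicomponent h f k l (pt i) (pt j) =
  eigenval n k g * eigenval n l g * bicomponent h f k l x y.
Proof.
move=> hP cub gk gl Sx Sy; rewrite /bicomponent mulr_sumr.
under eq_bigr => i _ do under eq_bigr => j _ do rewrite mulr_sumr.
under eq_bigr => i _ do rewrite exchange_big /=.
rewrite exchange_big /=; apply: eq_bigr => a _.
have [hx _ _] := hP (mnmx a); have [hy _ _] := hP (mnmy a).
have -> : eigenval n k g * eigenval n l g *
    (f@_a * ((h (mnmx a) k).@[x] * (h (mnmy a) l).@[y])) =
  f@_a * ((eigenval n k g * (h (mnmx a) k).@[x]) *
          (eigenval n l g * (h (mnmy a) l).@[y])) by ring.
rewrite -(funk_hecke n_gt0 cub gk Sx (hx k)) -(funk_hecke n_gt0 cub gl Sy (hy l)).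
rewrite mulr_suml [RHS]mulr_sumr; apply: eq_bigr => i _.
rewrite [X in _ = _ * X]mulr_sumr [RHS]mulr_sumr; apply: eq_bigr => j _.
by move: (meval _ _) (meval _ _) => X Y; ring.
Qed.

End Biharmonic.

(** * The factors of the kernel as polynomials *)

Section Ridge.
Variables (R : realType) (n : nat).
Implicit Types (s : 'I_n -> 'I_(n + n)) (z : 'I_n -> R) (u : {poly R}).

(** With s = [lshift n] or [@rshift n n] this is u(x . z) or u(y . z); products of two such are the
    polynomials to be squared. *)
Definition ridge s z u : {mpoly R[n + n]} :=
  \sum_(k < size u) u`_k *: (\sum_(l < n) z l *: 'X_(s l)) ^+ k.

Lemma eval_ridge s z u v :
  (ridge s z u).@[v] = u.[dotp (fun l => v (s l)) z].
Proof.
rewrite /ridge meval_sum horner_coef; apply: eq_bigr => k _.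
rewrite mevalZ rmorphXn /= meval_sum; congr (_ * _ ^+ _); apply: eq_bigr => l _.
by rewrite mevalZ mevalXU mulrC.
Qed.

Lemma ridge_deg (f : 'X_{1..n + n} -> nat) s z u t c :
  f 0%MM = 0%N -> (forall a b, f (a + b)%MM = (f a + f b)%N) ->
  (forall l, f U_(s l)%MM <= c)%N -> (size u <= t.+1)%N ->
  deg_le f (t * c) (ridge s z u).
Proof.
move=> f0 fD fs ut; apply: deg_le_sum => k _; apply: deg_leZ.
apply: (@deg_leW _ _ _ (k * c)).
  by rewrite leq_mul2r -ltnS (leq_trans (ltn_ord k) ut) orbT.
apply: deg_leX => //; apply: deg_le_sum => l _; apply: deg_leZ.
exact: deg_le_monomial.
Qed.

Lemma degx_lshift (l : 'I_n) : (degx U_(lshift n l) <= 1)%N.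
Proof. by have := mdeg1 (lshift n l); rewrite mdeg_xy => <-; exact: leq_addr. Qed.
Lemma degy_rshift (l : 'I_n) : (degy U_(rshift n l) <= 1)%N.
Proof. by have := mdeg1 (rshift n l); rewrite mdeg_xy => <-; exact: leq_addl. Qed.
Lemma degx_rshift (l : 'I_n) : (degx U_(rshift n l) <= 0)%N.
Proof. by rewrite /degx big1 // => i _; rewrite mnm1E eq_rlshift. Qed.
Lemma degy_lshift (l : 'I_n) : (degy U_(lshift n l) <= 0)%N.
Proof. by rewrite /degy big1 // => i _; rewrite mnm1E eq_lrshift. Qed.

Lemma ridge_prod_deg z z' u u' t : (size u <= t.+1)%N -> (size u' <= t.+1)%N ->
  deg_le (@degx n) t (ridge (lshift n) z u * ridge (@rshift n n) z' u') /\
  deg_le (@degy n) t (ridge (lshift n) z u * ridge (@rshift n n) z' u').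
Proof.
move=> su su'; split.
  have := deg_leM (@degxD n)
    (ridge_deg (z := z) (@degx0 n) (@degxD n) degx_lshift su)
    (ridge_deg (z := z') (@degx0 n) (@degxD n) degx_rshift su').
  by rewrite muln1 muln0 addn0.
have := deg_leM (@degyD n)
  (ridge_deg (z := z) (@degy0 n) (@degyD n) degy_lshift su)
  (ridge_deg (z := z') (@degy0 n) (@degyD n) degy_rshift su').
by rewrite muln1 muln0 add0n.
Qed.

End Ridge.

(** After the reversal k -> d - k, row k has k + 1 admissible l, and 1 + ... + (d + 1) is the
    binomial. *)
Lemma count_pairs d :
  (\sum_(k < d.+1) \sum_(l < d.+1) (k + l <= d) = 'C(d + 2, 2))%N.
Proof.
rewrite addn2 -bin2_sum big_mkord [RHS]big_ord_recl [RHS]add0n.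
rewrite (reindex_inj rev_ord_inj); apply: eq_bigr => k _.
have kd := ltn_ord k; rewrite lift0 /=.
rewrite [RHS](_ : _ = (\sum_(l < k.+1) 1)%N); last by rewrite sum1_card card_ord.
rewrite (big_ord_widen d.+1 (fun=> 1%N) kd) [RHS]big_mkcond.
apply: eq_bigr => l _; rewrite ltnS.
have -> : (d.+1 - k.+1 + l <= d)%N = (l <= k)%N by apply/idP/idP; lia.
by case: leqP.
Qed.

(** * Certificates for nonnegative polynomials on X *)

Section MainBound.
Variable R : realType.

Lemma Xset_coord_le1 n (v : 'I_(n + n) -> R) i : Xset n v -> `|v i| <= 1.
Proof.
case=> hx hy; case: (split_ordP i) => j ->.
  exact: (sphere_coord_le1 j hx).
exact: (sphere_coord_le1 j hy).
Qed.

Lemma Xset_nonempty n : (0 < n)%N -> exists v : 'I_(n + n) -> R, Xset n v.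
Proof.
case: n => // n _; pose e (i : 'I_n.+1) : R := (i == ord0)%:R.
have he : sphere n.+1 e.
  rewrite /sphere /= big_ord_recl /e eqxx expr1n big1 ?addr0 // => i _.
  by rewrite expr0n.
by exists (point e e); exact: Xset_point.
Qed.

Lemma qmin_qmax_bounds n (q : {mpoly R[n + n]}) v : Xset n v ->
  qmin n q <= q.@[v] <= qmax n q.
Proof.
move=> hv; have bnd w : Xset n w -> `|q.@[w]| <= \sum_(a <- msupp q) `|q@_a|.
  by move=> hw; apply: meval_bound => i; exact: Xset_coord_le1.
apply/andP; split.
  apply: ge_inf; last by exists v.
  exists (- \sum_(a <- msupp q) `|q@_a|) => _ [w hw <-].
  by have := bnd w hw; rewrite ler_norml => /andP[].
apply: ub_le_sup; last by exists v.
exists (\sum_(a <- msupp q) `|q@_a|) => _ [w hw <-].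
by have := bnd w hw; rewrite ler_norml => /andP[].
Qed.

Lemma pdeg_deg_le n t d (f : {mpoly R[n + n]}) : (pdeg f <= d)%N -> (d <= t)%N ->
  deg_le (@degx n) t.*2 f /\ deg_le (@degy n) t.*2 f.
Proof.
move=> /pdeg_leP fd dt; split=> a /fd; rewrite mdeg_xy; lia.
Qed.

(* On S^0 x S^0, a set of four points, interpolation replaces the kernel argument. *)
Lemma in_TX_nonneg_dim1 t (f : {mpoly R[1 + 1]}) : (0 < t)%N -> (pdeg f <= t)%N ->
  (forall v, Xset 1 v -> 0 <= f.@[v]) -> in_TX 1 (2 * t) f.
Proof.
move=> t0 ft f0; have [fx fy] := pdeg_deg_le ft (leqnn t).
pose e (b : bool) (i : 'I_1) : R := (-1) ^+ b.
have Se b : sphere 1 (e b) by rewrite /sphere /= big_ord1 sqrr_sign.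
(* u(1) = 1 and u(-1) = 0, so the products of ridges are the indicator functions of the four
   points. *)
pose u : {poly R} := 2^-1 *: (1 + 'X).
have su : (size u <= t.+1)%N.
  apply: leq_trans (_ : 2 <= _)%N; last by rewrite ltnS.
  rewrite (leq_trans (size_scale_leq _ _)) // (leq_trans (size_polyD _ _)) //.
  by rewrite size_poly1 size_polyX.
pose F (b : bool * bool) : {mpoly R[1 + 1]} :=
  ridge (lshift 1) (e b.1) u * ridge (@rshift 1 1) (e b.2) u.
apply: (@in_TX_certificate R 1 isT _ (fun b => f.@[point (e b.1) (e b.2)]) F) => //.
- by move=> b; apply: f0; exact: Xset_point.
- by move=> b; have [] := @ridge_prod_deg R 1 (e b.1) (e b.2) u u t su su.
- by move=> b; have [] := @ridge_prod_deg R 1 (e b.1) (e b.2) u u t su su.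
have sgn (z : 'I_1 -> R) : sphere 1 z -> exists b : bool, z ord0 = (-1) ^+ b.
  rewrite /sphere /= big_ord1 => /eqP; rewrite sqrf_eq1 => /orP[/eqP ->|/eqP ->].
    by exists false.
  by exists true; rewrite expr1.
move=> v [/sgn[b1 hb1] /sgn[b2 hb2]].
have uE (z : 'I_1 -> R) (b c : bool) : z ord0 = (-1) ^+ c ->
    u.[dotp z (e b)] = (c == b)%:R.
  move=> zc; rewrite /u !hornerE /dotp big_ord1 zc /e -signr_addb.
  by case: b; case: c {zc}; rewrite /= ?expr1 ?expr0; field.
under eq_bigr => b _.
  rewrite /F mevalM !eval_ridge (uE (fun l => v (lshift 1 l)) _ _ hb1) (uE (fun l => v (rshift 1 l)) _ _ hb2).
  over.
rewrite (bigD1 (b1, b2)) //= !eqxx mulr1 expr1n mulr1 big1 ?addr0; last first.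
  move=> [c1 c2]; rewrite xpair_eqE negb_and => /orP[]; rewrite eq_sym => /negPf -> /=.
    by rewrite mul0r expr0n mulr0.
  by rewrite mulr0 expr0n mulr0.
rewrite meval_point; apply: meval_eq => i; rewrite /point.
by case: split => j; rewrite /= [j]ord1 ?hb1 ?hb2.
Qed.

Lemma in_TX_nonneg n d t (f : {mpoly R[n + n]}) (M : R) (i j : 'I_n) : i != j ->
  (0 < d)%N -> (2 * n * d)%:R * Num.sqrt d%:R <= t%:R :> R ->
  (pdeg f <= d)%N -> (forall v, Xset n v -> 0 <= f.@[v] <= M) ->
  in_TX n (2 * t) (f + (CX n d / t%:R ^+ 2 * M)%:MP).
Proof.
move=> ij d0 ht fd fM.
have n0 : (0 < n)%N := leq_ltn_trans (leq0n i) (ltn_ord i).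
have dt := level_ge n0 d0 ht; have t0 := level_gt0 n0 d0 ht.
have [u [su E0 ratio]] := kernel_ratio n0 d0 ht ij.
have [h hP'] := harm_decomp_monomials R n0; have hP : monomial_decomp h := hP'.
(* The integrands multiply g, of degree at most 2t, by components of degree at most d. *)
have [I [w [pt cub]]] := cubature_exists R (t.*2 + d) n0.
have [w0 _ wS _] := cub.
set eps := CX n d / t%:R ^+ 2 * M.
pose g := u ^+ 2; pose E k := eigenval n k g.
rewrite -/g -/(E 0%N) in E0 ratio.
pose c k l := E 0%N ^+ 2 / (E k * E l).
(* The image of f + eps under the inverse of the kernel operator, normalised to fix constants. *)
pose H x y := \sum_(k < d.+1) \sum_(l < d.+1) c k l * bicomponent h f k l x y + eps.
have fS x y : sphere n x -> sphere n y -> 0 <= f.@[point x y] <= M.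
  by move=> Sx Sy; apply: fM; exact: Xset_point.
have fabs x y : sphere n x -> sphere n y -> `|f.@[point x y]| <= M.
  by move=> Sx Sy; have /andP[f0 f1] := fS x y Sx Sy; rewrite ger0_norm.
have H0 x y : sphere n x -> sphere n y -> 0 <= H x y.
  move=> Sx Sy; have /andP[f0 _] := fS x y Sx Sy.
  set K := 8 * n%:R ^+ 2 * d%:R ^+ 3 / t%:R ^+ 2 in ratio.
  (* Passing to H lowers each component by at most this much; summed over the ['C(d + 2, 2)] pairs
     the bound is exactly eps. *)
  have term k l : (k <= d)%N -> (l <= d)%N ->
      bicomponent h f k l x y - c k l * bicomponent h f k l x y <=
      K * (gammaS n d ^+ 2 * M) * (k + l <= d)%N%:R.
    move=> kd ld; have [kl|kl] := leqP (k + l) d; last first.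
      by rewrite (bicomponent_gt n0 hP fd) // !mulr0 subr0.
    have [_ rkl] := ratio k l kl; rewrite mulr1 -/(c k l) in rkl *.
    apply: le_trans (ler_norm _) _.
    rewrite -[X in X - _]mul1r -mulrBl normrM distrC.
    apply: ler_pM => //; exact: (bicomponent_bound n0 hP fd fabs).
  have -> : H x y = f.@[point x y] + eps - \sum_(k < d.+1) \sum_(l < d.+1)
      (bicomponent h f k l x y - c k l * bicomponent h f k l x y).
    under [X in _ - X]eq_bigr do rewrite sumrB.
    rewrite sumrB -(sum_bicomponent n0 hP fd) // /H; ring.
  rewrite subr_ge0; apply: (@le_trans _ _ eps); last by rewrite lerDr.
  apply: (@le_trans _ _ (\sum_(k < d.+1) \sum_(l < d.+1)
     K * (gammaS n d ^+ 2 * M) * (k + l <= d)%N%:R)).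
    apply: ler_sum => k _; apply: ler_sum => l _.
    by apply: term; rewrite -ltnS.
  under eq_bigr do rewrite -mulr_sumr -natr_sum.
  rewrite -mulr_sumr -natr_sum count_pairs /eps /CX /K.
  by rewrite le_eqVlt; apply/orP; left; apply/eqP; ring.
have sg : (size g <= t.*2.+1)%N.
  rewrite /g (leq_trans (size_poly_exp_leq _ _)) // ltnS.
  by move: su; case: (size u) => [|m] //= ; lia.
have e2 : 0 < E 0%N ^+ 2 by rewrite exprn_gt0.
pose F (z : I * I) : {mpoly R[n + n]} :=
  ridge (lshift n) (pt z.1) u * ridge (@rshift n n) (pt z.2) u.
pose W (z : I * I) := w z.1 * w z.2 * H (pt z.1) (pt z.2) / E 0%N ^+ 2.
have [px py] : deg_le (@degx n) t.*2 (f + eps%:MP) /\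
    deg_le (@degy n) t.*2 (f + eps%:MP).
  have [fx fy] := pdeg_deg_le fd dt.
  split; apply: deg_leD => //; apply: deg_leC; [exact: degx0 | exact: degy0].
apply: (@in_TX_certificate R n n0 _ W F) => //.
- by move=> z; rewrite /W divr_ge0 ?(ltW e2) // !mulr_ge0 // H0.
- by move=> z; have [] := @ridge_prod_deg R n (pt z.1) (pt z.2) u u t su su.
- by move=> z; have [] := @ridge_prod_deg R n (pt z.1) (pt z.2) u u t su su.
move=> v hv; rewrite mevalD mevalC meval_point.
set x := fun i => v (lshift n i); set y := fun i => v (rshift n i).
have Sx : sphere n x := hv.1.
have Sy : sphere n y := hv.2.
pose G z1 z2 := g.[dotp x (pt z1)] * g.[dotp y (pt z2)].
pose V (z : I * I) := w z.1 * w z.2 * G z.1 z.2.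
have -> : \sum_z W z * (F z).@[v] ^+ 2 =
    (E 0%N ^+ 2)^-1 * \sum_z V z * H (pt z.1) (pt z.2).
  rewrite mulr_sumr; apply: eq_bigr => z _.
  rewrite /F mevalM !eval_ridge /W /V /G /g !horner_exp -/x -/y; ring.
have HE x' y' : H x' y' = \sum_(p : 'I_d.+1 * 'I_d.+1)
    c p.1 p.2 * bicomponent h f p.1 p.2 x' y' + eps.
  by rewrite /H (pair_bigA _ (fun k l : 'I_d.+1 => c k l * bicomponent h f k l x' y')).
have sumV : \sum_z V z = E 0%N ^+ 2.
  have h1 := @harm_homog1 R n.
  have one z : sphere n z -> \sum_i w i * g.[dotp z (pt i)] = E 0%N.
    move=> Sz; have := funk_hecke n0 cub (g := g) (k := 0) (f := 1) _ Sz h1.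
    rewrite addn0 meval1 mulr1 -/(E 0%N) => <-; last by lia.
    by apply: eq_bigr => i' _; rewrite meval1 mulr1.
  rewrite -(pair_bigA _ (fun a b => V (a, b))) expr2 -{1}(one x Sx) -(one y Sy).
  rewrite mulr_suml; apply: eq_bigr => a _; rewrite mulr_sumr.
  by apply: eq_bigr => b _; rewrite /V /G /=; ring.
have sumVH (p : 'I_d.+1 * 'I_d.+1) :
    \sum_z V z * bicomponent h f p.1 p.2 (pt z.1) (pt z.2) =
    E p.1 * E p.2 * bicomponent h f p.1 p.2 x y.
  have p1 := ltn_ord p.1; have p2 := ltn_ord p.2.
  rewrite -(bicomponent_kernel n0 f hP cub _ _ Sx Sy); try lia.
  rewrite -(pair_bigA _ (fun a b =>
    V (a, b) * bicomponent h f p.1 p.2 (pt a) (pt b))) /=.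
  by apply: eq_bigr.
have -> : \sum_z V z * H (pt z.1) (pt z.2) =
    \sum_(p : 'I_d.+1 * 'I_d.+1) c p.1 p.2 * (E p.1 * E p.2 *
      bicomponent h f p.1 p.2 x y) + eps * E 0%N ^+ 2.
  rewrite -sumV mulr_sumr.
  under [X in _ = X + _]eq_bigr do rewrite -sumVH mulr_sumr.
  rewrite exchange_big -big_split; apply: eq_bigr => z _.
  rewrite HE mulrDr mulr_sumr mulrC; congr (_ + _).
  by apply: eq_bigr => p _; rewrite mulrCA.
rewrite mulrDr mulr_sumr mulrCA mulVf ?mulr1 ?lt0r_neq0 //; congr (_ + _).
rewrite (sum_bicomponent n0 hP fd) //.
rewrite (pair_bigA _ (fun k l : 'I_d.+1 => bicomponent h f k l x y)); apply: eq_bigr => p _ /=.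
(* [c k l] cancels the eigenvalues produced by the kernel; for k + l > d the component itself is
   0. *)
have [kl|kl] := leqP (p.1 + p.2) d; last first.
  by rewrite (bicomponent_gt n0 hP fd) // !mulr0.
have [Ek _] := ratio _ _ kl.
have El : 0 < E p.2.
  by have := ratio p.2 p.1; rewrite addnC => /(_ kl) [].
by rewrite /c; field; rewrite !lt0r_neq0.
Qed.

Lemma CX_ge0 (n d : nat) : 0 <= CX n d :> R.
Proof. by rewrite /CX mulr_ge0 ?sqr_ge0 // -!natrX -!natrM ler0n. Qed.

End MainBound.

Theorem theorem3 (R : realType) (n d : nat) (q : RPoly R (n + n)) (t : nat) :
  (1 <= n)%N -> (1 <= d)%N -> pdeg q = d ->
  (2 * n * d)%:R * Num.sqrt (d%:R) <= (t%:R : R) ->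
  ((qmin n q)%:E - lbTX n q (2 * t) <=
     (CX n d / (t%:R ^+ 2) * (qmax n q - qmin n q))%:E)%E.
Proof.
move=> n0 d0 qd ht.
set M := qmax n q - qmin n q; set eps := CX n d / t%:R ^+ 2 * M.
have bnd v : Xset n v -> 0 <= (q - (qmin n q)%:MP).@[v] <= M.
  move=> /(qmin_qmax_bounds q) /andP[h1 h2].
  by rewrite mevalB mevalC subr_ge0 h1 lerD2r.
have fd : (pdeg (q - (qmin n q)%:MP) <= d)%N.
  apply/pdeg_leP; apply: deg_leB; first by apply/pdeg_leP; rewrite qd.
  by apply: deg_leC; exact: mdeg0.
have dt := level_ge n0 d0 ht; have t0 := level_gt0 n0 d0 ht.
have eps0 : 0 <= eps.
  have [v hv] := Xset_nonempty R n0; have /andP[h1 h2] := bnd v hv.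
  have M0 := le_trans h1 h2.
  by rewrite /eps mulr_ge0 // divr_ge0 ?CX_ge0 ?exprn_ge0 ?ler0n.
have cert : in_TX n (2 * t) (q - (qmin n q)%:MP + eps%:MP).
  (* For n = 1 there is no second coordinate for the eigenvalue bounds, and interpolation takes
     over. *)
  have [n1|n2] := leqP n 1; last first.
    exact: (@in_TX_nonneg R n d t _ M (Ordinal n0) (Ordinal n2)).
  have n1' : n = 1%N by lia.
  subst n.
  apply: in_TX_nonneg_dim1 => // [|v /bnd /andP[h1 _]].
    apply/pdeg_leP; apply: deg_leD; first by apply/pdeg_leP; exact: leq_trans dt.
    by apply: deg_leC; exact: mdeg0.
  by rewrite mevalD mevalC addr_ge0.
have : ((qmin n q - eps)%:E <= lbTX n q (2 * t))%E.
  apply: ereal_sup_ubound; exists (qmin n q - eps) => //=.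
  move: cert; congr in_TX; rewrite /pconst mpolyCB; ring.
(* If the supremum is +oo the left side is -oo; the value -oo is excluded by the bound just
   proved. *)
case: (lbTX n q (2 * t)) => [r| |] //=.
- by rewrite !lee_fin; lra.
by rewrite leNye.
Qed.
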